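(* Let $k\ge 2$ and $m$ be positive integers, $n=km$, and let $G\sim\mathcal{G}_{p,q,k}$ with $k=O(\log m)$, $p=\frac{\alpha\log m}{m}$ and $q=\frac{\beta\log m}{m}$, where $\alpha>\beta>0$ are fixed constants. Then, with probability $1-n^{-\Omega(1)}$, the semidefinite program \[ \max\ A(G)\bullet Y\quad\text{s.t.}\quad \sum_j Y_{ij}+\sum_j Y_{ji}=2n/k\ (\forall i),\quad Y_{ii}=1\ (\forall i),\quad Y_{ij}\ge 0\ (\forall i,j),\quad Y\succeq 0 \] recovers the hidden clusters (i.e. its unique optimal solution is $Y^*$, where $Y^*_{ij}=1$ if $i,j$ lie in the same hidden cluster and $Y^*_{ij}=0$ otherwise), in each of the following cases: \begin{itemize} \item $k=o(\log n)$ and $\sqrt{\alpha}-\sqrt{\beta}>1$; \item $k=(\gamma+o(1))\log n$ for a fixed $\gamma>0$ and \[ \sqrt{\alpha}-\sqrt{\beta}>\sqrt{1+c\sqrt{\beta\gamma}\left(1+\log\sqrt{\alpha/\beta}\right)}, \] where $c$ is a universal constant. \end{itemize}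
   Context: The stochastic block model $\mathcal{G}_{p,q,k}$: the vertex set $V=[n]$, $n=km$, is partitioned into $k$ hidden clusters $P_1,\dots,P_k$ each of size $m=n/k$; a random graph $G$ on $V$ is formed by including each pair of vertices in the same cluster as an edge independently with probability $p$ and each pair in different clusters independently with probability $q$, where $p>q$. $A(G)$ is the adjacency matrix of $G$, and $A\bullet Y=\mathrm{Trace}(A^TY)$. All logarithms are natural. Asymptotics are as $n\to\infty$. *)

(* Defs.v *)
From HB Require Import structures.
From mathcomp Require Import all_boot all_order all_algebra.
From mathcomp Require Import all_classical all_reals all_analysis.
Set Implicit Arguments.
Unset Strict Implicit.
Unset Printing Implicit Defensive.
Import Order.TTheory GRing.Theory Num.Theory.
Import numFieldNormedType.Exports.
Local Open Scope ring_scope.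

(* A partition of the n vertices into k clusters is encoded by its labelling
   sigma : 'I_n -> 'I_k; the cluster P_a is the fibre of a. *)
Definition cluster (n k : nat) (sigma : 'I_n -> 'I_k) (a : 'I_k) : {set 'I_n} :=
  [set i | sigma i == a].

Definition equal_clusters (n k m : nat) (sigma : 'I_n -> 'I_k) : Prop :=
  forall a : 'I_k, #|cluster sigma a| = m.

(* A simple graph on 'I_n is its set of edges, i.e. a set of unordered pairs
   [set i; j] with i != j. *)
Definition vpairs (n : nat) : {set {set 'I_n}} := [set e : {set 'I_n} | #|e| == 2].

Definition simple_graph (n : nat) (G : {set {set 'I_n}}) : bool := G \subset vpairs n.

(* The diagonal vanishes on simple graphs since [set i; i] has one element. *)
Definition adjmx (R : realType) (n : nat) (G : {set {set 'I_n}}) : 'M[R]_n :=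
  \matrix_(i, j) ([set i; j] \in G)%:R.

Definition edge_prob (R : realType) (n k : nat) (p q : R) (sigma : 'I_n -> 'I_k)
    (e : {set 'I_n}) : R :=
  if [exists a : 'I_k, e \subset cluster sigma a] then p else q.

(* Probability mass of the graph G: the pairs are independent. It is a genuine
   probability distribution on simple graphs when p and q are in [0, 1]. *)
Definition sbm_mass (R : realType) (n k : nat) (p q : R) (sigma : 'I_n -> 'I_k)
    (G : {set {set 'I_n}}) : R :=
  \prod_(e in vpairs n)
    (if e \in G then edge_prob p q sigma e else 1 - edge_prob p q sigma e).

Definition sbm_prob (R : realType) (n k : nat) (p q : R) (sigma : 'I_n -> 'I_k)
    (Q : {set {set 'I_n}} -> Prop) : R :=
  \sum_(G : {set {set 'I_n}} | simple_graph G && `[< Q G >]) sbm_mass p q sigma G.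

(* Symmetry is part of the definition: it does not follow from nonnegativity of
   the quadratic form over the reals. *)
Definition psdmx (R : realType) (n : nat) (Y : 'M[R]_n) : Prop :=
  Y^T = Y /\ forall x : 'cV[R]_n, 0 <= (x^T *m Y *m x) 0 0.

Definition frob (R : realType) (n : nat) (A Y : 'M[R]_n) : R := \tr (A^T *m Y).

Definition sdp_feasible (R : realType) (n k : nat) (Y : 'M[R]_n) : Prop :=
  [/\ forall i, \sum_j Y i j + \sum_j Y j i = 2 * n%:R / k%:R,
      forall i, Y i i = 1,
      forall i j, 0 <= Y i j
    & psdmx Y].

Definition sdp_optimal (R : realType) (n k : nat) (A Y : 'M[R]_n) : Prop :=
  sdp_feasible k Y /\ forall Z : 'M[R]_n, sdp_feasible k Z -> frob A Z <= frob A Y.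

Definition clustermx (R : realType) (n k : nat) (sigma : 'I_n -> 'I_k) : 'M[R]_n :=
  \matrix_(i, j) (sigma i == sigma j)%:R.

Definition sdp_recovers (R : realType) (n k : nat) (sigma : 'I_n -> 'I_k)
    (G : {set {set 'I_n}}) : Prop :=
  forall Y : 'M[R]_n, sdp_optimal k (adjmx R G) Y <-> Y = clustermx R sigma.

Local Open Scope classical_set_scope.
Local Open Scope ring_scope.

(* The instances are indexed by t, with k t clusters of size m t, and
   p = alpha log m / m, q = beta log m / m. These may exceed 1 for small m, but
   only large t matter. The bound is uniform over the hidden partition. *)
Definition recovers_whp (R : realType) (alpha beta : R) (k m : nat -> nat) : Prop :=
  exists2 delta : R, 0 < delta &
    \forall t \near \oo, forall sigma : 'I_(k t * m t) -> 'I_(k t),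
      equal_clusters (m t) sigma ->
      1 - (k t * m t)%:R `^ (- delta) <=
      sbm_prob (alpha * ln (m t)%:R / (m t)%:R) (beta * ln (m t)%:R / (m t)%:R)
        sigma (sdp_recovers R sigma).

(* Main.v *)
(** Optimality of the cluster matrix is certified by SDP duality. Row multipliers
    close to the largest number of neighbours that a vertex has in a foreign
    cluster, together with a multiplier for Y >= 0 that is a sum of a row and a
    column function on every off-diagonal block, give a slack matrix that kills
    the cluster indicators. On their orthogonal complement it is positive as soon
    as every vertex has tau log m more neighbours in its own cluster than in any
    other one, tau log m exceeding the norm of the centered adjacency matrix by a
    small multiple of log m. Chernoff's bound at exp(theta) = sqrt(alpha / beta)
    yields such a degree gap with probability 1 - n^{-Omega(1)} as soon as
    (sqrt alpha - sqrt beta)^2 - theta tau > 1.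

    The norm bound O(sqrt(d + log n)) for edge densities of expected degree at most
    d comes from a trace comparison in the style of Bandeira and van Handel: with
    r = 2p >= 2 max(d, log n), the closed walks of length r contributing to
    E tr X^r are grouped by pattern and compared with those of an r x r symmetric
    matrix with independent bounded subgaussian entries, whose norm is controlled
    by a union bound over lattice points. Edges inside and across clusters are
    treated separately, so that the dominant term is sqrt(k beta log m). *)
Require Import Defs.
From HB Require Import structures.
From mathcomp Require Import all_boot all_order all_algebra.
From mathcomp Require Import all_classical all_reals all_analysis.
From mathcomp Require Import ring lra zify.
Set Implicit Arguments.
Unset Strict Implicit.
Unset Printing Implicit Defensive.
Import Order.TTheory GRing.Theory Num.Theory.
Import numFieldNormedType.Exports.
Local Open Scope ring_scope.


(** * Positive semidefinite matrices *)

Section Gram.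
Variables (R : realType) (n : nat).
Implicit Types (Y B : 'M[R]_n) (x z : 'cV[R]_n).

(** The threshold depends on letting the row multipliers vary with the vertex. A common multiplier
    would have to dominate the largest foreign degree in the whole graph, typically a constant
    factor above [beta * ln m]. With individual bounds [M i], only the degree gap at [i] and the
    average of [M] over the cluster of [i] enter. That average is at most [(beta + eps) * L] with
    high probability and is offset by [2 * h], where [h] is half a lower bound for the mean degree
    between two clusters. The trace comparison sees only the largest edge probability [rho] and the
    size [w] of the cell confining a walk. All edges at once would give the degree parameter
    [n * p], of order [k * alpha * L]. Splitting gives [m * p = alpha * L] inside clusters, whose
    square root is negligible against [L], and [n * q = k * beta * L] across them. Eigenvalues never
    occur: positive semidefinite matrices are split into rank-one terms by elimination, and norms
    are compared with traces by repeated squaring and Cauchy-Schwarz. The squaring is why trace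
    exponents are powers of two, at the cost of a factor 2 in the constant. *)

Definition qf B x : R := (x^T *m B *m x) 0 0.

Lemma qfE B x : qf B x = \sum_i \sum_j x i 0 * B i j * x j 0.
Proof.
rewrite /qf mxE exchange_big /=; apply: eq_bigr => j _.
rewrite mxE big_distrl /=; apply: eq_bigr => i _.
by rewrite !mxE.
Qed.

Lemma psd_sym Y i j : psdmx Y -> Y i j = Y j i.
Proof. by case=> sY _; rewrite -{1}sY mxE. Qed.

Lemma psd_qf Y x : psdmx Y -> 0 <= qf Y x.
Proof. by case=> _ h; exact: h. Qed.

(** Moving the test vector along one axis and choosing [t] well is the only use made of positivity:
    it gives [psd_row0], the elimination step and [psd_diag1_le1]. *)
Lemma qf_shift Y x i t : psdmx Y ->
  qf Y (x - t *: delta_mx i 0) = qf Y x - t * (\sum_j Y i j * x j 0) *+ 2 + t ^+ 2 * Y i i.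
Proof.
move=> pY; set y := delta_mx i 0.
have e1 (z : 'cV[R]_n) : (y^T *m Y *m z) 0 0 = \sum_j Y i j * z j 0.
  rewrite mxE; apply: eq_bigr => j _; congr (_ * _).
  rewrite trmx_delta -rowE mxE //.
have e2 : (x^T *m Y *m y) 0 0 = \sum_j Y i j * x j 0.
  rewrite -(e1 x) -[LHS](mxE trmx_key (fun a b => (x^T *m Y *m y) b a)) -/(trmx _).
  by rewrite !trmx_mul trmxK pY.1 mulmxA.
have e3 : (y^T *m Y *m y) 0 0 = Y i i.
  rewrite e1 (bigD1 i) //= big1 ?addr0 ?mxE ?eqxx ?mulr1 // => j ji.
  by rewrite mxE (negPf ji) mulr0.
have eT : (x - t *: y)^T = x^T - t *: y^T by rewrite linearB linearZ.
rewrite /qf eT !(mulmxBl, mulmxBr) -!(scalemxAl, scalemxAr).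
move: e1 e2 e3; set a := x^T *m Y *m x; set b := x^T *m Y *m y; set c := y^T *m Y *m y.
move=> /(_ x); set d := y^T *m Y *m x => e1 e2 e3.
clearbody a b c d; rewrite !mxE e1 e2 e3.
ring.
Qed.

Lemma psd_row0 Y i : psdmx Y -> Y i i = 0 -> forall j, Y i j = 0.
Proof.
move=> pY Yii j; apply/eqP; rewrite -[_ == 0]negbK; apply/negP => nz.
(* As [Y i i = 0], the form is affine in the shift; this shift makes its value -1. *)
have := psd_qf (delta_mx j 0 - ((Y j j + 1) / Y i j / 2) *: delta_mx i 0) pY.
rewrite qf_shift // Yii mulr0 addr0.
have -> : \sum_j0 Y i j0 * (delta_mx j 0 : 'cV[R]_n) j0 0 = Y i j.
  rewrite (bigD1 j) //= big1 ?addr0 ?mxE ?eqxx ?mulr1 // => l lj.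
  by rewrite mxE (negPf lj) mulr0.
have -> : qf Y (delta_mx j 0) = Y j j.
  rewrite /qf trmx_delta -rowE -colE !mxE //.
have -> : (Y j j + 1) / Y i j / 2 * Y i j *+ 2 = Y j j + 1 by field.
lra.
Qed.

(* Elimination with rank-one corrections; S is the set of rows already cleared. *)
Lemma gram_partial (s : nat) (S : {set 'I_n}) Y : #|~: S| = s -> psdmx Y ->
  (forall i j, i \in S -> Y i j = 0) ->
  exists vs : seq 'cV[R]_n, Y = \sum_(v <- vs) v *m v^T.
Proof.
elim: s S Y => [|s IH] S Y cS pY S0.
  exists [::]; rewrite big_nil; apply/matrixP => i j; rewrite mxE.
  apply: S0; rewrite -[S]finset.setCK (cards0_eq cS) finset.setC0 finset.in_setT //.
have [i iS] : exists i, i \in ~: S by apply/card_gt0P; rewrite cS.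
have cS' : #|~: (i |: S)| = s.
  by rewrite finset.setCU finset.setIC -finset.setDE; move: cS; rewrite (cardsD1 i) iS => -[].
have [Yii|Yii] := eqVneq (Y i i) 0.
  apply: (IH (i |: S)) => // a b; rewrite finset.in_setU1 => /orP[/eqP->|]; last exact: S0.
  exact: psd_row0.
have Yp : 0 < Y i i.
  rewrite lt_neqAle eq_sym Yii /=.
  have := psd_qf (delta_mx i 0) pY.
  by rewrite /qf trmx_delta -rowE -colE !mxE.
pose w : 'cV[R]_n := (Num.sqrt (Y i i))^-1 *: col i Y.
have sq : (Num.sqrt (Y i i))^-1 * (Num.sqrt (Y i i))^-1 = (Y i i)^-1.
  by rewrite -invfM -expr2 sqr_sqrtr // ltW.
have wE a b : (w *m w^T) a b = Y i a * Y i b / Y i i.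
  rewrite mxE big_ord1 !mxE (psd_sym i a pY) (psd_sym i b pY) -sq; ring.
have [vs vsE] : exists vs : seq 'cV[R]_n, Y - w *m w^T = \sum_(v <- vs) v *m v^T.
  apply: (IH (i |: S)) => //.
    split; first by rewrite linearB /= trmx_mul trmxK pY.1.
    (* The shift [l / Y i i] minimizes the form of [Y] along the axis [i], and the minimum is the
       form of the Schur complement at [x]. *)
    move=> x; set l := \sum_j Y i j * x j 0.
    have := psd_qf (x - (l / Y i i) *: delta_mx i 0) pY.
    rewrite qf_shift // -/l.
    have -> : qf Y x = (x^T *m (Y - w *m w^T) *m x) 0 0 + l ^+ 2 / Y i i.
      rewrite mulmxBr mulmxBl [X in _ = X + _]mxE -/(qf Y x) -addrA; apply/eqP.
      rewrite eq_sym -[X in _ == X]addr0 (inj_eq (addrI _)) [X in X + _]mxE addrC subr_eq0; apply/eqP.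
      rewrite -/(qf (w *m w^T) x) qfE.
      rewrite expr2 big_distrlr /= big_distrl /=; apply: eq_bigr => a _.
      rewrite big_distrl /=; apply: eq_bigr => b _; rewrite wE; ring.
    have -> : l / Y i i * l *+ 2 = 2 * (l^+2 / Y i i) by ring.
    have -> : (l / Y i i) ^+ 2 * Y i i = l ^+ 2 / Y i i by field.
    lra.
  move=> a b; rewrite finset.in_setU1 => /orP[/eqP->|aS].
    rewrite !mxE big_ord1 !mxE (psd_sym b i pY).
    have -> : (Num.sqrt (Y i i))^-1 * Y i i * ((Num.sqrt (Y i i))^-1 * Y i b) =
     ((Num.sqrt (Y i i))^-1 * (Num.sqrt (Y i i))^-1) * Y i i * Y i b by ring.
    by rewrite sq mulVf // mul1r subrr.
  have wab : (w *m w^T) a b = 0 by rewrite wE (psd_sym i a pY) S0 // !mul0r.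
  by rewrite mxE S0 // add0r mxE wab oppr0.
exists (w :: vs); rewrite big_cons -vsE addrC subrK //.
Qed.

(** Lets a lower bound for the quadratic form of the slack matrix, known vector by vector, be summed
    to a bound for its pairing with a feasible [Y]. *)
Lemma psd_gram Y : psdmx Y -> exists vs : seq 'cV[R]_n, Y = \sum_(v <- vs) v *m v^T.
Proof.
move=> pY; apply: (@gram_partial #|~: (finset.set0 : {set 'I_n})| finset.set0) => // i j.
by rewrite finset.in_set0.
Qed.

Lemma psd_diag1_le1 Y i j : psdmx Y -> (forall i, Y i i = 1) -> Y i j <= 1.
Proof.
move=> pY Y1.
have := psd_qf (delta_mx j 0 - 1 *: delta_mx i 0) pY.
rewrite qf_shift // Y1.
have -> : \sum_j0 Y i j0 * (delta_mx j 0 : 'cV[R]_n) j0 0 = Y i j.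
  rewrite (bigD1 j) //= big1 ?addr0 ?mxE ?eqxx ?mulr1 // => l lj.
  by rewrite mxE (negPf lj) mulr0.
have -> : qf Y (delta_mx j 0) = 1.
  rewrite /qf trmx_delta -rowE -colE !mxE //.
rewrite mul1r; lra.
Qed.

End Gram.

(** * The dual certificate *)

Section Certificate.
Variables (R : realType) (n k m : nat) (sigma : 'I_n -> 'I_k).
Hypotheses (nE : n = (k * m)%N) (eqc : equal_clusters m sigma) (k_gt0 : (0 < k)%N) (m_gt0 : (0 < m)%N).
Implicit Types (A Y : 'M[R]_n) (M v : 'I_n -> R).

Definition deg_to A (b : 'I_k) (i : 'I_n) : R := \sum_(j | sigma j == b) A i j.
Definition cross_deg A (a b : 'I_k) : R := \sum_(i | sigma i == a) deg_to A b i.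
Definition cavg M (a : 'I_k) : R := (\sum_(i | sigma i == a) M i) / m%:R.

Let nR : n%:R = k%:R * m%:R :> R. Proof. by rewrite -natrM -nE. Qed.

Let m0 : m%:R != 0 :> R. Proof. by rewrite pnatr_eq0 -lt0n. Qed.

Lemma sum_cluster_const (c : R) a : \sum_(i | sigma i == a) c = m%:R * c.
Proof.
rewrite sumr_const mulr_natl; congr (_ *+ _).
by rewrite -(eqc a); apply: eq_card => i; rewrite inE.
Qed.

Lemma sum_by_cluster (F : 'I_n -> R) : \sum_i F i = \sum_a \sum_(i | sigma i == a) F i.
Proof. by rewrite (partition_big sigma predT). Qed.

Lemma sum_cluster_fun v (f : 'I_k -> R) :
  \sum_i f (sigma i) * v i = \sum_a f a * \sum_(i | sigma i == a) v i.
Proof.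
rewrite sum_by_cluster; apply: eq_bigr => a _; rewrite big_distrr /=.
by apply: eq_bigr => i /eqP ->.
Qed.

Lemma sum_cluster_fun0 v (f : 'I_k -> R) :
  (forall a, \sum_(i | sigma i == a) v i = 0) -> \sum_i f (sigma i) * v i = 0.
Proof. by move=> h; rewrite sum_cluster_fun big1 // => a _; rewrite h mulr0. Qed.

Lemma cross_deg_sym A a b : A^T = A -> cross_deg A a b = cross_deg A b a.
Proof.
move=> sA; rewrite /cross_deg /deg_to exchange_big /=; apply: eq_bigr => i _.
by apply: eq_bigr => j _; rewrite -{1}sA mxE.
Qed.

Lemma frobE A Y : frob A Y = \sum_i \sum_j A i j * Y i j.
Proof.
rewrite /frob /mxtrace exchange_big; apply: eq_bigr => i _ /=.
by rewrite !mxE; apply: eq_bigr => j _; rewrite !mxE.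
Qed.

Lemma feasible_row Y i : sdp_feasible k Y -> \sum_j Y i j = m%:R.
Proof.
case=> h _ _ pY; move: (h i).
have -> : \sum_j Y j i = \sum_j Y i j by apply: eq_bigr => j _; rewrite (psd_sym j i pY).
rewrite nR => {}h.
have k0 : k%:R != 0 :> R by rewrite pnatr_eq0 -lt0n.
have : 2 * (k%:R * m%:R) / k%:R = m%:R + m%:R :> R by field.
by rewrite -h; lra.
Qed.

Lemma clustermx_feasible : sdp_feasible k (clustermx R sigma).
Proof.
have k0 : k%:R != 0 :> R by rewrite pnatr_eq0 -lt0n.
have row i : \sum_j clustermx R sigma i j = m%:R.
  under eq_bigr do rewrite mxE eq_sym.
  rewrite -[m%:R]mulr1 -(sum_cluster_const 1 (sigma i)) [RHS]big_mkcond; apply: eq_bigr => j _.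
  by case: eqP.
have sym : (clustermx R sigma)^T = clustermx R sigma.
  by apply/matrixP => i j; rewrite !mxE eq_sym.
split.
- move=> i; rewrite row.
  have -> : \sum_j clustermx R sigma j i = \sum_j clustermx R sigma i j.
    by apply: eq_bigr => j _; rewrite -{1}sym mxE.
  by rewrite row nR; field.
- by move=> i; rewrite mxE eqxx.
- by move=> i j; rewrite mxE ler0n.
- split => // x; rewrite -/(qf _ _) qfE.
  pose s a := \sum_(i | sigma i == a) x i 0.
  have -> : \sum_i \sum_j x i 0 * clustermx R sigma i j * x j 0 = \sum_a s a ^+ 2.
    rewrite sum_by_cluster; apply: eq_bigr => a _.
    rewrite expr2 {1}/s big_distrl /=; apply: eq_bigr => i /eqP ia.
    rewrite /s big_distrr /= [RHS]big_mkcond; apply: eq_bigr => j _.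
    by rewrite mxE ia eq_sym; case: eqP => _; rewrite ?mulr1 ?mulr0 ?mul0r.
  by apply: sumr_ge0 => a _; exact: sqr_ge0.
Qed.

(** [M] dominates the foreign degrees, [2 * h] is a lower bound for the mean degree between two
    clusters, [N] bounds the form of [A] off the cluster indicators, and the surplus [del] makes the
    optimum unique. *)
Variables (A : 'M[R]_n) (M : 'I_n -> R) (h N del : R).
Hypotheses (sA : A^T = A) (del_gt0 : 0 < del).
Hypothesis degM : forall i b, b != sigma i -> deg_to A b i <= M i.
Hypothesis cross_deg_ge : forall a b, a != b -> 2 * h * m%:R <= cross_deg A a b.
Hypothesis gap : forall i,
  N + del <= deg_to A (sigma i) i - M i + 2 * h - cavg M (sigma i).
Hypothesis specA : forall v, (forall a, \sum_(i | sigma i == a) v i = 0) ->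
  \sum_i \sum_j v i * A i j * v j <= N * \sum_i v i ^+ 2.

(* Dual variables: u i / m for the row sum constraint i, D i for Y i i = 1, Z for
   Y >= 0, and the slack matrix W. The value of H off the own cluster is forced by
   W having zero sums over every cluster, and makes W differ from diag D - A only
   by terms that vanish on the orthogonal complement of the cluster indicators. *)
Let u i := M i - h.
Let D i := deg_to A (sigma i) i - u i - cavg u (sigma i).
Let H i b := if sigma i == b then u i / m%:R
  else (deg_to A b i - cross_deg A (sigma i) b / (2 * m%:R)) / m%:R.
Let Z i j := (u i + u j) / m%:R - H i (sigma j) - H j (sigma i).
Let W i j := (i == j)%:R * D i - A i j + H i (sigma j) + H j (sigma i).

Let cavg_u a : cavg u a = cavg M a - h.
Proof.
by rewrite /cavg /u big_split /= sum_cluster_const; field.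
Qed.

Let D_ge i : N + del <= D i.
Proof. by rewrite /D cavg_u /u; move: (gap i); lra. Qed.

Let W_sym i j : W i j = W j i.
Proof.
rewrite /W -{1}sA mxE eq_sym; have [->//|_] := eqVneq j i.
by rewrite !mul0r; ring.
Qed.

(** On a foreign block each side carries half of the mean cross degree. [H i a] contributes the
    degree minus one half, the column terms contribute the other half, and symmetry of [cross_deg]
    makes them match. On the own block the equation defines [D]. *)
Let W_cluster i a : \sum_(j | sigma j == a) W i j = 0.
Proof.
have -> : \sum_(j | sigma j == a) W i j =
  (\sum_(j | sigma j == a) (i == j)%:R * D i) - deg_to A a i + m%:R * H i a
  + \sum_(j | sigma j == a) H j (sigma i).
  rewrite -(sum_cluster_const _ a) /deg_to -sumrB -!big_split /=.
  by apply: eq_bigr => j /eqP ja; rewrite /W ja.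
have [ia|ia] := eqVneq (sigma i) a.
  have -> : \sum_(j | sigma j == a) (i == j)%:R * D i = D i.
    rewrite (bigD1 i) ?ia //= eqxx mul1r big1 ?addr0 // => j /andP[_ ji].
    by rewrite eq_sym (negPf ji) mul0r.
  rewrite /H ia eqxx.
  have -> : \sum_(j | sigma j == a) (if sigma j == a then u j / m%:R else
     (deg_to A a j - cross_deg A (sigma j) a / (2 * m%:R)) / m%:R) = cavg u a.
    by rewrite /cavg big_distrl /=; apply: eq_bigr => j ->.
  by rewrite /D ia; field.
rewrite big1 ?add0r => [|j /eqP ja]; last first.
  by have [ij|] := eqVneq i j; rewrite ?mul0r // -ja ij eqxx in ia *.
have -> : \sum_(j | sigma j == a) H j (sigma i) =
  \sum_(j | sigma j == a) (deg_to A (sigma i) j - cross_deg A a (sigma i) / (2 * m%:R)) / m%:R.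
  by apply: eq_bigr => j /eqP ja; rewrite /H ja eq_sym (negPf ia).
rewrite -big_distrl /= sumrB -/(cross_deg A a (sigma i)) sum_cluster_const.
rewrite /H (negPf ia) (cross_deg_sym (sigma i) a sA); by field.
Qed.

(** On a foreign block [m * Z i j] is the sum of two nonnegative excesses [M - deg_to] and of the
    mean cross degree minus [2 * h]; this is what limits [h]. On own blocks [Z] vanishes, which is
    complementary slackness with the cluster matrix. *)
Let Z_ge0 i j : 0 <= Z i j.
Proof.
have mp : 0 < (m%:R : R) by rewrite ltr0n.
have [ij|ij] := eqVneq (sigma i) (sigma j).
  rewrite /Z /H ij eqxx.
  suff -> : (u i + u j) / m%:R - u i / m%:R - u j / m%:R = 0 by [].
  by field.
have d1 : deg_to A (sigma j) i <= M i by apply: degM; rewrite eq_sym.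
have d2 := degM ij.
have c := cross_deg_ge ij.
suff -> : Z i j = ((M i - deg_to A (sigma j) i) + (M j - deg_to A (sigma i) j)
   + (cross_deg A (sigma i) (sigma j) / m%:R - 2 * h)) / m%:R.
  apply: divr_ge0; last exact: ltW.
  have : 2 * h <= cross_deg A (sigma i) (sigma j) / m%:R by rewrite ler_pdivlMr.
  lra.
rewrite /Z /H (negPf ij) eq_sym (negPf ij) (cross_deg_sym (sigma j) (sigma i) sA) /u.
by field.
Qed.

(** The factor of [del] is the squared norm of [v'], which is [v] minus its cluster averages. Since
    [W] kills the cluster indicators, [v] may be replaced by [v']; there each [H] term vanishes,
    being constant on clusters in one index. *)
Let W_psd v : del * (\sum_i v i ^+ 2 - (\sum_i \sum_(j | sigma j == sigma i) v i * v j) / m%:R)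
   <= \sum_i \sum_j v i * W i j * v j.
Proof.
pose v' i := v i - cavg v (sigma i).
have v'0 a : \sum_(i | sigma i == a) v' i = 0.
  rewrite sumrB [X in _ - X](_ : _ = m%:R * cavg v a).
    by rewrite /cavg mulrC divfK // subrr.
  by rewrite -(sum_cluster_const _ a); apply: eq_bigr => i /eqP ->.
have Wc i : \sum_j W i j * cavg v (sigma j) = 0.
  under eq_bigr do rewrite mulrC.
  by apply: sum_cluster_fun0 => a; exact: W_cluster.
have -> : \sum_i \sum_j v i * W i j * v j = \sum_i \sum_j v' i * W i j * v' j.
  have e1 : \sum_i \sum_j v i * W i j * v j = \sum_i \sum_j v i * W i j * v' j.
    apply: eq_bigr => i _; apply/eqP; rewrite -subr_eq0 -sumrB; apply/eqP.
    transitivity (v i * \sum_j W i j * cavg v (sigma j)); last by rewrite Wc mulr0.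
    rewrite big_distrr /=; apply: eq_bigr => j _.
    by rewrite /v'; ring.
  rewrite e1 exchange_big [RHS]exchange_big /=; apply: eq_bigr => j _.
  apply/eqP; rewrite -subr_eq0 -sumrB; apply/eqP.
  transitivity (v' j * \sum_i W j i * cavg v (sigma i)); last by rewrite Wc mulr0.
  rewrite big_distrr /=; apply: eq_bigr => i _.
  by rewrite /v' (W_sym j i); ring.
have -> : \sum_i \sum_j v' i * W i j * v' j =
  \sum_i D i * v' i ^+ 2 - \sum_i \sum_j v' i * A i j * v' j.
  rewrite -sumrB.
  transitivity (\sum_i (D i * v' i ^+ 2 - \sum_j v' i * A i j * v' j +
     v' i * \sum_j H j (sigma i) * v' j)).
    apply: eq_bigr => i _.
    transitivity (\sum_j ((i == j)%:R * D i * v' i * v' j - v' i * A i j * v' j +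
       v' i * (H j (sigma i) * v' j) + v' i * (H i (sigma j) * v' j))).
      by apply: eq_bigr => j _; rewrite /W; ring.
    rewrite !big_split /= -!big_distrr /= (sum_cluster_fun0 _ v'0) mulr0 addr0.
    congr (_ + _ + _).
      rewrite (bigD1 i) //= eqxx big1 => [|j ji]; last by rewrite eq_sym (negPf ji) !mul0r.
      by rewrite addr0 mul1r -mulrA -expr2.
    by rewrite sumrN.
  rewrite big_split /= [X in _ + X](_ : _ = 0) ?addr0 //.
  under eq_bigr do rewrite mulrC.
  exact: (sum_cluster_fun0 (fun a => \sum_j H j a * v' j) v'0).
have nv' : \sum_i v' i ^+ 2 =
   \sum_i v i ^+ 2 - (\sum_i \sum_(j | sigma j == sigma i) v i * v j) / m%:R.
  have -> : \sum_i v' i ^+ 2 = \sum_i v i ^+ 2 - \sum_i cavg v (sigma i) * v i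
     - \sum_i cavg v (sigma i) * v' i.
    by rewrite -!sumrB; apply: eq_bigr => i _; rewrite /v'; ring.
  rewrite (sum_cluster_fun0 _ v'0) subr0; congr (_ - _).
  rewrite big_distrl /=; apply: eq_bigr => i _.
  by rewrite -big_distrr /= /cavg mulrC mulrA.
rewrite -nv'; have := specA v'0.
have : (N + del) * \sum_i v' i ^+ 2 <= \sum_i D i * v' i ^+ 2.
  rewrite big_distrr /=; apply: ler_sum => i _.
  by apply: ler_wpM2r; rewrite ?sqr_ge0.
lra.
Qed.

(** The entries of [A + Z + W] are those of the diagonal [D] plus [(u i + u j) / m], which the
    constraints evaluate. The value is the same for all feasible [Y], so objectives can be compared
    through [Z] and [W] alone. *)
Let frob_W Y : sdp_feasible k Y ->
  frob A Y + \sum_i \sum_j Z i j * Y i j + \sum_i \sum_j W i j * Y i j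
   = \sum_i D i + 2 * \sum_i u i.
Proof.
move=> fY; have [_ Y1 _ pY] := fY.
rewrite frobE -!big_split /=.
transitivity (\sum_i (D i + u i + \sum_j u j / m%:R * Y i j)).
  apply: eq_bigr => i _; rewrite -!big_split /=.
  transitivity (\sum_j ((i == j)%:R * D i * Y i j + (u i / m%:R * Y i j + u j / m%:R * Y i j))).
    by apply: eq_bigr => j _; rewrite /Z /W; ring.
  rewrite 2!big_split /= addrA; congr (_ + _ + _).
    rewrite (bigD1 i) //= eqxx Y1 big1 => [|j ji]; last by rewrite eq_sym (negPf ji) !mul0r.
    by rewrite addr0 mul1r mulr1.
  by rewrite -big_distrr /= feasible_row // divfK.
rewrite big_split /= exchange_big /= [X in X + _]big_split /=.
have -> : \sum_j \sum_i u j / m%:R * Y i j = \sum_j u j.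
  apply: eq_bigr => j _; rewrite -big_distrr /=.
  have -> : \sum_i Y i j = \sum_i Y j i by apply: eq_bigr => i _; rewrite (psd_sym i j pY).
  by rewrite feasible_row // divfK.
ring.
Qed.

(** Weak duality with a remainder: the factor of [del] measures how far the diagonal blocks of [Y]
    are from all ones, and that remainder yields uniqueness. *)
Let frob_gap Y : sdp_feasible k Y ->
  frob A Y + del * (n%:R - (\sum_i \sum_(j | sigma j == sigma i) Y i j) / m%:R)
    <= frob A (clustermx R sigma).
Proof.
move=> fY; have [_ Y1 Y0 pY] := fY.
have e1 := frob_W fY.
have e2 := frob_W clustermx_feasible.
have z1 : 0 <= \sum_i \sum_j Z i j * Y i j.
  by apply: sumr_ge0 => i _; apply: sumr_ge0 => j _; rewrite mulr_ge0.
have z2 : \sum_i \sum_j Z i j * clustermx R sigma i j = 0.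
  rewrite big1 // => i _; rewrite big1 // => j _; rewrite mxE.
  case: eqP => [ij|]; last by rewrite mulr0.
  by rewrite /Z /H ij eqxx; field.
have w2 : \sum_i \sum_j W i j * clustermx R sigma i j = 0.
  rewrite big1 // => i _; transitivity (\sum_(j | sigma j == sigma i) W i j); last exact: W_cluster.
  rewrite [RHS]big_mkcond.
  by apply: eq_bigr => j _; rewrite mxE eq_sym; case: eqP; rewrite ?mulr1 ?mulr0.
suff : del * (n%:R - (\sum_i \sum_(j | sigma j == sigma i) Y i j) / m%:R)
   <= \sum_i \sum_j W i j * Y i j by move: e1 e2 z1; rewrite z2 w2; lra.
have [vs vsE] := psd_gram pY.
have YE i j : Y i j = \sum_(v <- vs) v i 0 * v j 0.
  rewrite vsE summxE; apply: eq_bigr => v _.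
  by rewrite mxE big_ord1 mxE.
have -> : \sum_i \sum_j W i j * Y i j =
   \sum_(v <- vs) \sum_i \sum_j v i 0 * W i j * v j 0.
  rewrite [RHS]exchange_big; apply: eq_bigr => i _ /=.
  rewrite [RHS]exchange_big; apply: eq_bigr => j _ /=.
  rewrite YE big_distrr /=; apply: eq_bigr => v _; ring.
apply: le_trans (_ : \sum_(v <- vs) del * (\sum_i v i 0 ^+ 2 -
  (\sum_i \sum_(j | sigma j == sigma i) v i 0 * v j 0) / m%:R) <= _); last first.
  by apply: ler_sum => v _; exact: (W_psd (fun i => v i 0)).
rewrite -big_distrr /= sumrB -big_distrl /= le_eqVlt; apply/orP; left; apply/eqP.
congr (_ * (_ - _ / _)).
  rewrite exchange_big /= -[LHS]mulr1 -[n in n%:R]card_ord -sum1_card natr_sum mulr_suml.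
  apply: eq_bigr => i _; rewrite mul1r -(Y1 i) YE; apply: eq_bigr => v _; ring.
rewrite [RHS]exchange_big; apply: eq_bigr => i _ /=.
by rewrite [RHS]exchange_big; apply: eq_bigr => j _ /=; rewrite YE.
Qed.

(** An optimal [Y] has zero defect. Its entries are at most 1, so those inside clusters equal 1.
    They already exhaust the row sum [m], and nonnegativity makes the others 0. *)
Lemma certificate_recovers Y : sdp_optimal k A Y <-> Y = clustermx R sigma.
Proof.
have mp : 0 < (m%:R : R) by rewrite ltr0n.
have tot : \sum_i \sum_(j | sigma j == sigma i) (1 : R) = n%:R * m%:R.
  under eq_bigr do rewrite sum_cluster_const mulr1.
  by rewrite sumr_const card_ord mulr_natl.
have defect Y' : sdp_feasible k Y' ->
  n%:R - (\sum_i \sum_(j | sigma j == sigma i) Y' i j) / m%:R =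
  (\sum_i \sum_(j | sigma j == sigma i) (1 - Y' i j)) / m%:R.
  move=> _; under [X in _ = X / _]eq_bigr do rewrite sumrB.
  by rewrite sumrB tot mulrBl mulfK.
have defect0 Y' : sdp_feasible k Y' ->
  0 <= \sum_i \sum_(j | sigma j == sigma i) (1 - Y' i j).
  case=> _ Y1 _ pY; apply: sumr_ge0 => i _; apply: sumr_ge0 => j _.
  by rewrite subr_ge0 psd_diag1_le1.
split=> [[fY opt]|->]; last first.
  split=> [|Y' fY']; first exact: clustermx_feasible.
  apply: le_trans (frob_gap fY'); rewrite lerDl; apply: mulr_ge0; first exact: ltW.
  by rewrite defect // divr_ge0 ?defect0 // ltW.
have g := le_trans (frob_gap fY) (opt _ clustermx_feasible).
have [_ Y1 Y0 pY] := fY.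
have dz : \sum_i \sum_(j | sigma j == sigma i) (1 - Y i j) = 0.
  apply/eqP; rewrite eq_le defect0 // andbT.
  move: g; rewrite gerDl defect // pmulr_rle0 // ler_pdivrMr // mul0r //.
have Ysame i j : sigma j == sigma i -> Y i j = 1.
  move=> ij; have /psumr_eq0P := dz.
  move=> /(_ (fun i _ => sumr_ge0 _ _)) dz'.
  have {}dz' : \sum_(j | sigma j == sigma i) (1 - Y i j) = 0.
    by apply: dz' => // i0 j0 _; rewrite subr_ge0 psd_diag1_le1.
  move/psumr_eq0P: dz' => dz'; apply/esym/eqP; rewrite -subr_eq0; apply/eqP.
  by apply: dz' => // j0 _; rewrite subr_ge0 psd_diag1_le1.
apply/matrixP => i j; rewrite mxE eq_sym.
have [ij|ij] := boolP (sigma j == sigma i); first by rewrite Ysame.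
have := feasible_row i fY.
rewrite (bigID (fun j => sigma j == sigma i)) /= (eq_bigr (fun=> 1)); last by exact: Ysame.
rewrite sum_cluster_const mulr1 => /eqP; rewrite -[X in _ == X]addr0 (inj_eq (addrI _)) => /eqP.
by move/psumr_eq0P => -> // l _.
Qed.

End Certificate.
(** * Independent random bits and closed walks *)

Section Bits.
Variables (R : realType) (I : finType).
Implicit Types (pr w : I -> R) (G : {set I}) (f g : {set I} -> R).

Definition bits_mass pr G : R := \prod_i (if i \in G then pr i else 1 - pr i).
Definition bits_E pr f : R := \sum_(G : {set I}) bits_mass pr G * f G.

Lemma bits_E_prod pr (f : I -> bool -> R) :
  bits_E pr (fun G => \prod_i f i (i \in G)) =
  \prod_i (pr i * f i true + (1 - pr i) * f i false).
Proof.
rewrite bigA_distr; apply: eq_bigr => G _.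
rewrite /bits_mass -big_split /=; apply: eq_bigr => i _.
by case: ifP.
Qed.

(** Repeated letters of the word are gathered into powers of one bit, after which independence
    factors the expectation. The words in view are the edge lists of closed walks. *)
Lemma bits_E_word pr (v : I -> bool -> R) (L : seq I) :
  bits_E pr (fun G => \prod_(i <- L) v i (i \in G)) =
  \prod_i (pr i * v i true ^+ count_mem i L + (1 - pr i) * v i false ^+ count_mem i L).
Proof.
rewrite -(bits_E_prod pr (fun i b => v i b ^+ count_mem i L)).
apply: eq_bigr => G _; congr (_ * _).
elim: L => [|j L IH]; first by rewrite big_nil big1 // => i _; rewrite expr0.
rewrite big_cons IH (bigD1 j) //= [RHS](bigD1 j) //= eqxx exprS mulrA; congr (_ * _).
by apply: eq_bigr => i ij; rewrite eq_sym (negPf ij).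
Qed.

Lemma eq_bits_E pr f g : (forall G, f G = g G) -> bits_E pr f = bits_E pr g.
Proof. by move=> fg; apply: eq_bigr => G _; rewrite fg. Qed.

Lemma bits_E1 pr : bits_E pr (fun=> 1) = 1.
Proof.
transitivity (bits_E pr (fun=> \prod_(i : I) 1)).
  by apply: eq_bits_E => G; rewrite big1.
rewrite (bits_E_prod pr (fun _ _ => 1)) big1 // => i _.
by rewrite !mulr1 addrC subrK.
Qed.

Lemma bits_E_sum pr (J : Type) (s : seq J) (P : pred J) (F : J -> {set I} -> R) :
  bits_E pr (fun G => \sum_(j <- s | P j) F j G) = \sum_(j <- s | P j) bits_E pr (F j).
Proof.
by rewrite exchange_big; apply: eq_bigr => G _ /=; rewrite big_distrr.
Qed.

Lemma bits_ED pr f g : bits_E pr (fun G => f G + g G) = bits_E pr f + bits_E pr g.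
Proof. by rewrite -big_split; apply: eq_bigr => G _; rewrite mulrDr. Qed.

Lemma bits_EZ pr c f : bits_E pr (fun G => c * f G) = c * bits_E pr f.
Proof. by rewrite big_distrr; apply: eq_bigr => G _ /=; rewrite mulrCA. Qed.

Variable pr : I -> R.
Hypothesis pr01 : forall i, 0 <= pr i <= 1.

Lemma bits_mass_ge0 G : 0 <= bits_mass pr G.
Proof.
apply: prodr_ge0 => i _; have /andP[p0 p1] := pr01 i.
by case: ifP => _ //; rewrite subr_ge0.
Qed.

Lemma ler_bits_E f g : (forall G, f G <= g G) -> bits_E pr f <= bits_E pr g.
Proof. by move=> fg; apply: ler_sum => G _; rewrite ler_wpM2l // bits_mass_ge0. Qed.

Lemma bits_mgf w :
  bits_E pr (fun G => expR (\sum_(i in G) w i)) <= expR (\sum_i pr i * (expR (w i) - 1)).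
Proof.
have -> : bits_E pr (fun G => expR (\sum_(i in G) w i)) =
  \prod_i (pr i * expR (w i) + (1 - pr i) * 1).
  rewrite -(bits_E_prod pr (fun i (b : bool) => if b then expR (w i) else 1)).
  by apply: eq_bits_E => G; rewrite expR_sum big_mkcond.
rewrite expR_sum; apply: ler_prod => i _; have /andP[p0 p1] := pr01 i.
apply/andP; split.
  by rewrite addr_ge0 // ?mulr_ge0 ?expR_ge0 // subr_ge0.
apply: le_trans (expR_ge1Dx _); lra.
Qed.

End Bits.

(** * Closed walks: vertices against distinct edges *)

Section ClosedWalks.
Variable T : finType.
Implicit Types (u s t : seq T) (x y : T).

(** Pairing [u] with its rotation closes the walk. A step that stays put gives a singleton, so
    diagonal entries are covered too. *)
Definition walk_edges u : seq {set T} := [seq [set p.1; p.2] | p <- zip u (rot 1 u)].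
Definition no_single_edge u := all (fun e => count_mem e (walk_edges u) != 1) (walk_edges u).
Definition num_vertices u := size (undup u).

Lemma size_walk_edges u : size (walk_edges u) = size u.
Proof. by rewrite size_map size1_zip // size_rot. Qed.

Lemma mem_zip_pair s t x y : (x, y) \in zip s t -> x \in s /\ y \in t.
Proof.
elim: s t => [|a s IH] [|b t] //=; rewrite !inE => /orP[|/IH[-> ->]]; last by rewrite !orbT.
by case/eqP => -> ->; rewrite !eqxx.
Qed.

(** A starting vertex that never recurs brings an edge that never recurs; otherwise neither count
    needs to grow. *)
Lemma vertices_le_path x t :
  (size (undup (x :: t)) <=
   (size (undup [seq [set p.1; p.2] | p <- zip (x :: t) t])).+1)%N.
Proof.
elim: t x => [|y t IH] x //=.
have xt : x \notin y :: t -> [set x; y] \notin [seq [set p.1; p.2] | p <- zip (y :: t) t].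
  apply: contra => /mapP[[a b] /= ab /setP/(_ x)].
  rewrite !inE eqxx /= => /esym xab.
  have : a \in y :: t /\ b \in t by exact: mem_zip_pair.
  by rewrite inE => -[at_ bt]; move: xab => /orP[/eqP->|/eqP->] //; rewrite bt orbT.
have := IH y; rewrite [zip (y :: t) t]lock [y :: t]lock /= -!lock => IHy.
case: (boolP (x \in y :: t)) => [xin|/xt /negPf -> //].
case: ([set x; y] \in _); first exact: IHy.
exact: leqW IHy.
Qed.

Lemma num_vertices_le u : (num_vertices u <= (size (undup (walk_edges u))).+1)%N.
Proof.
case: u => [|x t] //; rewrite /num_vertices /walk_edges rot1_cons.
have -> : zip (x :: t) (rcons t x) = zip (x :: rcons t x) (rcons t x).
  elim: t {1 3}x => [|y t IH] z //=; by rewrite IH.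
apply: leq_trans (vertices_le_path x (rcons t x)).
have : undup (x :: t) =i undup (x :: rcons t x).
  by move=> y; rewrite !mem_undup !inE mem_rcons inE; case: eqP.
by move/uniq_perm => /(_ (undup_uniq _) (undup_uniq _)) /perm_size ->.
Qed.

(** Every distinct edge is used at least twice. Together with [num_vertices_le], a walk of length
    [2 * p] has at most [p + 1] vertices. *)
Lemma no_single_edge_size u : no_single_edge u ->
  (2 * size (undup (walk_edges u)) <= size u)%N.
Proof.
move/allP => nu; rewrite -size_walk_edges; set L := walk_edges u in nu *.
rewrite -(perm_size (perm_count_undup L)) size_flatten /shape -map_comp.
have : all (fun e => 1 < size (nseq (count_mem e L) e))%N (undup L).
  apply/allP => e; rewrite mem_undup size_nseq => eL.
  by have := nu e eL; have : (0 < count_mem e L)%N by [rewrite -has_count has_pred1]; lia.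
by elim: (undup L) => //= e L' IH /andP[eL /IH]; lia.
Qed.

End ClosedWalks.
Section WalkImage.
Variables (T S : finType) (f : T -> S) (u : seq T).
Hypothesis f_inj : {in u &, injective f}.

Lemma walk_edges_map : walk_edges (map f u) = [seq f @: e | e : {set T} <- walk_edges u].
Proof.
rewrite /walk_edges -map_rot -map_comp.
elim: u (rot 1 u) => [|a s IH] [|b t] //=; rewrite IH; congr (_ :: _).
by rewrite imsetU1 imset_set1.
Qed.

Lemma walk_edges_sub (e : {set T}) : e \in walk_edges u -> {subset e <= u}.
Proof.
move=> /mapP[[a b] /mem_zip_pair[]]; rewrite mem_rot => au bu -> x.
by rewrite !inE => /orP[] /eqP->.
Qed.

Lemma imset_sub_inj (e e' : {set T}) : {subset e <= u} -> {subset e' <= u} ->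
  f @: e = f @: e' -> e = e'.
Proof.
move=> eu e'u E; apply/setP => x; apply/idP/idP => xe.
  have /imsetP[y ye' fxy] : f x \in f @: e' by rewrite -E imset_f.
  by rewrite (f_inj (eu _ xe) (e'u _ ye') fxy).
have /imsetP[y ye fxy] : f x \in f @: e by rewrite E imset_f.
by rewrite (f_inj (e'u _ xe) (eu _ ye) fxy).
Qed.

Lemma no_single_edge_map : no_single_edge (map f u) = no_single_edge u.
Proof.
rewrite /no_single_edge walk_edges_map all_map; apply: eq_in_all => e eu /=.
congr (_ != _); rewrite count_map; apply: eq_in_count => e' e'u /=.
apply/eqP/eqP => [|-> //]; apply: imset_sub_inj; exact: walk_edges_sub.
Qed.

Lemma num_vertices_map : num_vertices (map f u) = num_vertices u.
Proof.
rewrite /num_vertices -(size_map f (undup u)); apply: perm_size.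
apply: uniq_perm; rewrite ?undup_uniq ?map_inj_in_uniq ?undup_uniq //.
  by move=> x y; rewrite !mem_undup; exact: f_inj.
move=> y; rewrite mem_undup.
by apply/mapP/mapP => -[x xu ->]; exists x => //; rewrite mem_undup in xu *.
Qed.

End WalkImage.

Lemma index_map_in (T S : eqType) (f : T -> S) (s : seq T) x :
  {in s &, injective f} -> x \in s -> index (f x) (map f s) = index x s.
Proof.
elim: s => //= a s IH f_inj.
rewrite inE => /orP[/eqP->|xs]; first by rewrite !eqxx.
have ain : a \in a :: s by rewrite mem_head.
have xin : x \in a :: s by rewrite inE xs orbT.
have -> : (f a == f x) = (a == x) by apply/eqP/eqP => [/(f_inj _ _ ain xin)|->].
case: eqP => // _; congr _.+1; apply: IH => // y z ys zs.
by apply: f_inj; rewrite inE ?ys ?zs orbT.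
Qed.

(** * Counting the walks that share a pattern *)

Section Patterns.
Variable l : nat.
Implicit Types T S : finType.

(* The pattern is the word of first occurrences; two closed walks have the same
   pattern iff they differ by a bijection of their vertices. *)
Definition pattern T (u : l.+1.-tuple T) : l.+1.-tuple 'I_l.+1 :=
  map_tuple (fun x => inord (index x u)) u.

Lemma pattern_inj T (u : l.+1.-tuple T) :
  {in u &, injective (fun x => inord (index x u) : 'I_l.+1)}.
Proof.
move=> x y xu yu /(congr1 val); rewrite /= !inordK -1?{2}(size_tuple u) ?index_mem //.
  by move=> E; rewrite -(nth_index x xu) E nth_index.
Qed.

Lemma map_pattern T (u : l.+1.-tuple T) : map (tnth u) (pattern u) = u.
Proof.
rewrite -map_comp -[RHS]map_id; apply/eq_in_map => x xu /=.
have iu : (index x u < l.+1)%N by rewrite -{2}(size_tuple u) index_mem.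
by rewrite (tnth_nth x) inordK // nth_index.
Qed.

Lemma pattern_map T S (f : T -> S) (u : l.+1.-tuple T) (w : l.+1.-tuple S) :
  {in u &, injective f} -> map f u = w -> pattern w = pattern u.
Proof.
move=> f_inj E; apply: val_inj; rewrite /= -E -map_comp; apply/eq_in_map => x xu /=.
by congr inord; exact: (@index_map_in _ _ f u).
Qed.

Lemma no_single_edge_pattern T (u : l.+1.-tuple T) :
  no_single_edge (pattern u) = no_single_edge u.
Proof. exact/no_single_edge_map/pattern_inj. Qed.

Lemma num_vertices_pattern T (u : l.+1.-tuple T) :
  num_vertices (pattern u) = num_vertices u.
Proof. exact/num_vertices_map/pattern_inj. Qed.

Lemma pattern_pattern T (u : l.+1.-tuple T) : pattern (pattern u) = pattern u.
Proof. exact: (pattern_map (@pattern_inj _ u)). Qed.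

Lemma num_vertices_gt0 T (u : l.+1.-tuple T) : (0 < num_vertices u)%N.
Proof.
rewrite lt0n; apply/negP => /nilP /undup_nil E; have := size_tuple u.
by rewrite E.
Qed.

(** Cells are the fibres of [tau]: clusters for inner edges, a single cell for outer edges.
    Confinement to a cell replaces [n] by the cell size for all vertices but the first. *)
Definition in_one_cell T (C : eqType) (tau : T -> C) (u : seq T) :=
  if u is x :: s then all (fun y => tau y == tau x) s else true.

Lemma in_one_cellP T (C : eqType) (tau : T -> C) (u : seq T) x y :
  in_one_cell tau u -> x \in u -> y \in u -> tau x = tau y.
Proof.
case: u => //= z s /allP h.
have {}h y' : y' \in z :: s -> tau y' = tau z.
  by rewrite inE => /orP[/eqP-> //|/h/eqP].
by move=> /h -> /h ->.
Qed.

Lemma card_cell_ffun T (C : eqType) (tau : T -> C) (w v : nat) :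
  (forall x, #|[pred y | tau y == tau x]| <= w)%N ->
  (#|[set f : {ffun 'I_v.+1 -> T} | [forall i, tau (f i) == tau (f ord0)]]| <= #|T| * w ^ v)%N.
Proof.
move=> cw; pose F x (i : 'I_v.+1) := if i == ord0 then pred1 x else [pred y | tau y == tau x].
have cF x : (#|family (F x)| <= w ^ v)%N.
  rewrite card_family foldrE big_map big_enum big_ord_recl /F /= card1 mul1n.
  rewrite -[v in (w ^ v)%N]card_ord -prod_nat_const; apply: leq_prod => i _.
  exact: cw.
rewrite -sum1dep_card (partition_big (fun f : {ffun 'I_v.+1 -> T} => f ord0) predT) //=.
rewrite -sum_nat_const; apply: leq_sum => x _; apply: leq_trans (cF x).
rewrite sum1dep_card; apply: subset_leq_card; apply/fintype.subsetP => f.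
rewrite inE => /andP[/forallP h /eqP fx]; apply/familyP => i; rewrite /F.
case: eqP => [->|_]; first by rewrite inE fx.
by rewrite inE -fx h.
Qed.

(** Given its pattern, a walk is determined by its vertices at the distinct positions of first
    occurrence. The first vertex is arbitrary, and each other one lies in the same cell. *)
Lemma card_pattern_cell T (C : eqType) (tau : T -> C) (w : nat) (p : l.+1.-tuple 'I_l.+1) :
  (forall x, #|[pred y | tau y == tau x]| <= w)%N ->
  (#|[set u : l.+1.-tuple T | (pattern u == p) && in_one_cell tau u]|
    <= #|T| * w ^ (num_vertices p).-1)%N.
Proof.
move=> cw; apply: leq_trans (card_cell_ffun _ cw).
have [v Ev] : exists v, num_vertices p = v.+1.
  by exists (num_vertices p).-1; rewrite prednK // num_vertices_gt0.
rewrite Ev /=; pose s := undup p.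
pose phi (u : l.+1.-tuple T) := [ffun i : 'I_v.+1 => tnth u (nth ord0 s i)].
rewrite -(card_in_imset (f := phi)) => [|u u'].
  apply: subset_leq_card; apply/fintype.subsetP => g /imsetP[u]; rewrite inE => /andP[_ uc] ->.
  rewrite inE; apply/forallP => i; apply/eqP; rewrite !ffunE.
  by apply: (in_one_cellP uc); exact: mem_tnth.
rewrite !inE => /andP[/eqP pu _] /andP[/eqP pu' _] E; apply: val_inj => /=.
rewrite -(map_pattern u) -(map_pattern u') pu pu'; apply/eq_in_map => a ap.
have as_ : a \in s by rewrite mem_undup.
have ia : (index a s < v.+1)%N by rewrite -Ev index_mem.
by have := congr1 (fun g : {ffun _ -> T} => g (Ordinal ia)) E; rewrite !ffunE /= !nth_index.
Qed.

(** Every injective labelling of the vertices of a pattern produces a walk with that pattern. The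
    pattern has to come from a walk [u0], since a word that is not its own pattern is never
    realized. *)
Lemma card_pattern_ge (r : nat) T (u0 : l.+1.-tuple T) :
  (r ^_ (num_vertices (pattern u0)) <=
     #|[set u : l.+1.-tuple 'I_r | pattern u == pattern u0]|)%N.
Proof.
set p := pattern u0.
have [v Ev] : exists v, num_vertices p = v.+1.
  by exists (num_vertices p).-1; rewrite prednK // num_vertices_gt0.
rewrite Ev; pose s := undup p.
have idx a : a \in p -> (inord (index a s) : 'I_v.+1) = index a s :> nat.
  by move=> ap; rewrite inordK // -Ev index_mem mem_undup.
pose phi (f : {ffun 'I_v.+1 -> 'I_r}) : l.+1.-tuple 'I_r :=
  map_tuple (fun a => f (inord (index a s))) p.
rewrite -{1}[r]card_ord -[v.+1]card_ord -card_inj_ffuns.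
rewrite -(card_in_imset (f := phi)) => [|f f' _ _ E].
  apply: subset_leq_card; apply/fintype.subsetP => g /imsetP[f]; rewrite inE => /injectiveP fi ->.
  rewrite inE; apply/eqP; rewrite -[RHS]pattern_pattern.
  apply: (@pattern_map _ _ (fun a => f (inord (index a s)))) => //.
  move=> a b ap bp /fi /(congr1 val) /=; rewrite !idx // => E.
  have as_ : a \in s by rewrite mem_undup.
  have bs : b \in s by rewrite mem_undup.
  by rewrite -(nth_index a as_) E nth_index.
apply/ffunP => i; have si : (i < size s)%N by rewrite -/(num_vertices p) Ev.
have ip : nth ord0 s i \in p by rewrite -mem_undup mem_nth.
have := congr1 val E => /= /eq_in_map /(_ _ ip) /=.
by rewrite index_uniq ?undup_uniq // inord_val.
Qed.

End Patterns.
(** * The trace comparison *)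

Section TraceMoments.
Variable R : realType.

Lemma sum_tuple_cons (T : finType) l (F : l.+1.-tuple T -> R) :
  \sum_u F u = \sum_x \sum_(t : l.-tuple T) F [tuple of x :: t].
Proof.
rewrite pair_bigA /= (reindex (fun p : T * l.-tuple T => [tuple of p.1 :: p.2])) //=.
apply: onW_bij; exists (fun u : l.+1.-tuple T => (thead u, [tuple of behead u])).
  by case=> x t; rewrite /= theadE; congr (_, _); apply: val_inj.
by move=> u; rewrite /= -tuple_eta.
Qed.

Lemma mxpow_walk n (B : 'M[R]_n) l i j :
  (B ^+ l.+1) i j =
  \sum_(t : l.-tuple 'I_n) \prod_(x <- zip (i :: t) (rcons t j)) B x.1 x.2.
Proof.
elim: l i => [|l IH] i.
  rewrite (big_pred1 [tuple]) => [|t]; last by rewrite /= (tuple0 t); exact/esym/eqP.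
  by rewrite expr1 big_cons big_nil mulr1.
rewrite exprS mxE sum_tuple_cons; apply: eq_bigr => z _.
rewrite IH big_distrr; apply: eq_bigr => t _ /=.
by rewrite big_cons.
Qed.

Lemma mxtrace_walk n (B : 'M[R]_n) l :
  \tr (B ^+ l.+1) = \sum_(u : l.+1.-tuple 'I_n) \prod_(x <- zip u (rot 1 u)) B x.1 x.2.
Proof.
rewrite sum_tuple_cons; apply: eq_bigr => x _; rewrite mxpow_walk.
by apply: eq_bigr => t _; rewrite /= rot1_cons.
Qed.

Definition edge_mx n (v : {set 'I_n} -> bool -> R) (G : {set {set 'I_n}}) : 'M[R]_n :=
  \matrix_(i, j) v [set i; j] ([set i; j] \in G).

Definition walk_moment n (pr : {set 'I_n} -> R) v (u : seq 'I_n) : R :=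
  \prod_(e : {set 'I_n}) (pr e * v e true ^+ count_mem e (walk_edges u) +
                         (1 - pr e) * v e false ^+ count_mem e (walk_edges u)).

Lemma bits_E_trace n (pr : {set 'I_n} -> R) v l :
  bits_E pr (fun G => \tr (edge_mx v G ^+ l.+1)) =
  \sum_(u : l.+1.-tuple 'I_n) walk_moment pr v u.
Proof.
rewrite (eq_bits_E _ (fun G => mxtrace_walk _ _)) bits_E_sum; apply: eq_bigr => u _.
rewrite /walk_moment -bits_E_word; apply: eq_bits_E => G; rewrite big_map.
by apply: eq_bigr => x _; rewrite mxE.
Qed.

Lemma in_one_cell_edges (T : finType) (C : eqType) (tau : T -> C) (u : seq T) :
  (forall x y, [set x; y] \in walk_edges u -> tau x = tau y) -> in_one_cell tau u.
Proof.
case: u => // x t h.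
have {}h p : p \in zip (x :: t) (rcons t x) -> tau p.1 = tau p.2.
  move=> pz; apply: h; apply/mapP; exists p => //; by rewrite rot1_cons.
rewrite /in_one_cell; move: {2}x h => z; elim: t x => //= y t IH x h.
have -> : tau x = tau y by apply: (h (x, y)); rewrite mem_head.
rewrite eqxx /=; apply: IH => p pz.
by apply: h; rewrite inE pz orbT.
Qed.

Section Centered.
Variables (n : nat) (C : eqType) (tau : 'I_n -> C) (pr : {set 'I_n} -> R).
Variables (D : {set {set 'I_n}}) (rho : R).
Hypotheses (rho01 : 0 <= rho <= 1) (pr01 : forall e, 0 <= pr e <= 1).
Hypothesis pr_le : forall e, e \in D -> pr e <= rho.
Hypothesis D_cell : forall x y, tau x != tau y -> [set x; y] \notin D.

Definition centered (e : {set 'I_n}) (b : bool) : R := if e \in D then b%:R - pr e else 0.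

(** The values are bounded by 1, so a moment of order at least 2 is dominated by the variance
    [pr e * (1 - pr e)]. *)
Lemma centered_moment_le e c : (1 < c)%N ->
  `|pr e * centered e true ^+ c + (1 - pr e) * centered e false ^+ c| <= rho.
Proof.
case: c => [|[|c]] // _; have /andP[p0 pr1] := pr01 e; have /andP[rho0 rho1] := rho01.
rewrite /centered; case: ifP => [eD|_]; last by rewrite exprS !mul0r !mulr0 addr0 normr0.
rewrite sub0r; apply: le_trans (pr_le eD); apply: le_trans (ler_normD _ _) _.
have q0 : 0 <= 1 - pr e by rewrite subr_ge0.
rewrite [X in X + _]normrM [X in _ + X]normrM !normrX normrN (ger0_norm p0).
rewrite (ger0_norm q0) 4!exprS.
have a1 : (1 - pr e) ^+ c <= 1 by apply: exprn_ile1 => //; lra.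
have a2 : pr e ^+ c <= 1 by apply: exprn_ile1.
have a3 : 0 <= pr e ^+ c by apply: exprn_ge0.
have a4 : 0 <= (1 - pr e) ^+ c by apply: exprn_ge0.
apply: le_trans (_ : pr e * ((1 - pr e) * ((1 - pr e) * 1)) + (1 - pr e) * (pr e * (pr e * 1)) <= _).
  by apply: lerD; do ![apply: ler_wpM2l => //].
nra.
Qed.

(** An edge used once contributes its mean 0, and so does an edge outside [D]; a walk that leaves
    its cell uses such an edge. Otherwise each distinct edge costs at most [rho], and there are at
    least as many as vertices minus one. *)
Lemma walk_moment_centered u :
  walk_moment pr centered u <=
  (no_single_edge u && in_one_cell tau u)%:R * rho ^+ (num_vertices u).-1.
Proof.
have /andP[rho0 rho1] := rho01.
set L := walk_edges u.
have zero e : e \in L -> e \notin D \/ count_mem e L = 1%N -> walk_moment pr centered u = 0.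
  move=> eL h; apply/eqP; rewrite prodf_seq_eq0; apply/hasP; exists e; rewrite ?mem_index_enum //=.
  have c0 : (0 < count_mem e L)%N by rewrite -has_count has_pred1.
  rewrite /centered; case: h => [/negPf->|->].
    by rewrite expr0n eqn0Ngt c0 !mulr0 addr0.
  rewrite !expr1; case: ifP => _; last by rewrite !mulr0 addr0.
  by rewrite /= mulr1n mulr0n; apply/eqP; ring.
case: (boolP (no_single_edge u)) => [nu|/allPn[e eL]]; last first.
  by rewrite negbK => /eqP ce; rewrite (zero e) ?mul0r //; right.
have cL e : e \in L -> (1 < count_mem e L)%N.
  move=> eL; have := allP nu e eL; have : (0 < count_mem e L)%N by rewrite -has_count has_pred1.
  by rewrite -/L; case: (count_mem e L) => [|[|c]].
case: (boolP (in_one_cell tau u)) => [_|nc]; last first.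
  have [/existsP[x /existsP[y /andP[exy nt]]]|] :=
    boolP [exists x, exists y, ([set x; y] \in L) && (tau x != tau y)].
    by rewrite (zero [set x; y]) ?mul0r //; left; exact: D_cell.
  rewrite negb_exists => /forallP h; case/negP: nc; apply: in_one_cell_edges => x y xy.
  by have := h x; rewrite negb_exists => /forallP/(_ y); rewrite xy negbK => /eqP.
rewrite mul1r; apply: le_trans (ler_norm _) _; rewrite normr_prod.
apply: le_trans (_ : rho ^+ size (undup L) <= _).
  have -> : rho ^+ size (undup L) = \prod_(e : {set 'I_n}) (if e \in undup L then rho else 1).
    rewrite -big_mkcond -big_uniq ?undup_uniq //=.
    by rewrite big_const_seq count_predT iter_mulr_1.
  apply: ler_prod => e _; rewrite normr_ge0 /= mem_undup; case: ifP => eL.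
    exact: centered_moment_le (cL e eL).
  have -> : count_mem e L = 0%N by apply/count_memPn; rewrite eL.
  by rewrite !expr0 !mulr1 addrC subrK normr1.
apply: ler_wiXn2l => //; have := num_vertices_le u; rewrite -/L.
by case: num_vertices.
Qed.

End Centered.

(* With success probability 1/3 this law has mean 0 and all its higher moments,
   the odd ones included, are at least 1; a symmetric law would not dominate the
   odd moments of the centered edges. *)
Definition skew (b : bool) : R := if b then 2 else -1.

Lemma skew_moment_ge c :
  ((c != 1%N)%:R : R) <= (1/3) * skew true ^+ c + (1 - 1/3) * skew false ^+ c.
Proof.
rewrite /skew; case: c => [|[|[|c]]]; rewrite ?expr0 ?expr1 /=; try lra.
have h1 : (1 : R) <= 2 ^+ c by apply: exprn_ege1; lra.
have h2 : - 1 <= (-1 : R) ^+ c.+3 by rewrite -signr_odd; case: odd; rewrite ?expr0 ?expr1; lra.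
have -> : (2 : R) ^+ c.+3 = 8 * 2 ^+ c by rewrite !exprS; ring.
lra.
Qed.

Lemma walk_moment_skew n (u : seq 'I_n) :
  ((no_single_edge u)%:R : R) <= walk_moment (fun=> 1/3) (fun=> skew) u.
Proof.
case: (boolP (no_single_edge u)) => [/allP nu|_] /=; last first.
  by apply: prodr_ge0 => e _; apply: le_trans (skew_moment_ge _); rewrite ler0n.
apply: le_trans (_ : \prod_(e : {set 'I_n}) 1 <= _); first by rewrite big1.
apply: ler_prod => e _; rewrite ler01 /=.
apply: le_trans (skew_moment_ge _); suff -> : count_mem e (walk_edges u) != 1%N by [].
have [/nu //|/count_memPn -> //] := boolP (e \in walk_edges u).
Qed.

End TraceMoments.
Section TraceComparison.
Variable R : realType.

(** The first factor is [2 * p], and the [v] others are at least [2 * p - v], hence at least [p]. *)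
Lemma ffact_ge p v : (v <= p)%N -> (2 * p * p ^ v <= (2 * p) ^_ v.+1)%N.
Proof.
move=> vp; rewrite ffactnS leq_mul2l ffact_prod; apply/orP; right.
rewrite -[v in (_ ^ v)%N]card_ord -prod_nat_const; apply: leq_prod => i _.
by have := ltn_ord i; lia.
Qed.

(* A pattern with v + 1 vertices and no single edge has v <= p. It is realized by at
   most n w^v walks of probability at most rho^v on the left, and by at least
   r (r - p)^v >= r (w rho)^v walks of weight at least 1 on the right. *)
Lemma trace_comparison (n l p w : nat) (C : eqType) (tau : 'I_n -> C)
    (pr : {set 'I_n} -> R) (D : {set {set 'I_n}}) (rho : R) :
  l.+1 = (2 * p)%N -> 0 <= rho <= 1 -> w%:R * rho <= p%:R ->
  (forall e, 0 <= pr e <= 1) -> (forall e, e \in D -> pr e <= rho) ->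
  (forall x y, tau x != tau y -> [set x; y] \notin D) ->
  (forall x, #|[pred y | tau y == tau x]| <= w)%N ->
  l.+1%:R * bits_E pr (fun G => \tr (edge_mx (centered pr D) G ^+ l.+1)) <=
  n%:R * bits_E (fun=> 1/3) (fun G => \tr (edge_mx (n := l.+1) (fun=> @skew R) G ^+ l.+1)).
Proof.
move=> lp rho01 wrho pr01 prle Dc cw; have /andP[rho0 rho1] := rho01.
rewrite !bits_E_trace.
apply: le_trans (_ : l.+1%:R * \sum_(u : l.+1.-tuple 'I_n)
   (no_single_edge u && in_one_cell tau u)%:R * rho ^+ (num_vertices u).-1 <= _).
  apply: ler_wpM2l => //; apply: ler_sum => u _.
  exact: walk_moment_centered prle Dc _.
apply: le_trans (_ : n%:R * \sum_(u : l.+1.-tuple 'I_l.+1) (no_single_edge u)%:R <= _); last first.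
  by apply: ler_wpM2l => //; apply: ler_sum => u _; exact: walk_moment_skew.
rewrite (partition_big (@pattern l _) predT) //= big_distrr /=.
rewrite [X in _ * X](partition_big (@pattern l _) predT) //= [leRHS]big_distrr /=.
apply: ler_sum => q _.
have [/existsP[u0 /andP[/eqP u0q /andP[u0s u0c]]]|] := boolP [exists u : l.+1.-tuple 'I_n,
    (pattern u == q) && (no_single_edge u && in_one_cell tau u)]; last first.
  rewrite negb_exists => /forallP h; rewrite big1 ?mulr0 => [|u uq].
    by apply: mulr_ge0 => //; apply: sumr_ge0 => u _; exact: ler0n.
  by have := h u; rewrite uq /= => /negPf ->; rewrite mul0r.
have qs : no_single_edge q by rewrite -u0q no_single_edge_pattern.
set v := (num_vertices q).-1.
have vE : num_vertices q = v.+1 by rewrite /v -u0q prednK // num_vertices_gt0.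
have vp : (v <= p)%N.
  have := num_vertices_le u0; have := no_single_edge_size u0s.
  rewrite -num_vertices_pattern u0q vE size_tuple; move: (size (undup _)) => z.
  by clearbody v; clear -lp; lia.
apply: le_trans (_ : l.+1%:R * ((n * w ^ v)%:R * rho ^+ v) <= _).
  apply: ler_wpM2l => //.
  apply: le_trans (_ : #|[set u : l.+1.-tuple 'I_n | (pattern u == q) && in_one_cell tau u]|%:R * rho ^+ v <= _).
    rewrite -sum1dep_card natr_sum mulr_suml [leRHS]big_mkcond [leLHS]big_mkcond /=.
    apply: ler_sum => u _; case: (boolP (pattern u == q)) => //= /eqP uq.
    rewrite -num_vertices_pattern uq -/v; case: (in_one_cell tau u); rewrite ?andbF ?mul0r //.
    by rewrite andbT ler_wpM2r ?exprn_ge0 // lern1 leq_b1.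
  by rewrite ler_wpM2r ?exprn_ge0 // ler_nat -[n in (n * _)%N]card_ord card_pattern_cell.
apply: le_trans (_ : n%:R * #|[set u : l.+1.-tuple 'I_l.+1 | pattern u == q]|%:R <= _); last first.
  apply: ler_wpM2l => //; rewrite -sum1dep_card natr_sum; apply: ler_sum => u /eqP uq.
  by rewrite -no_single_edge_pattern uq qs.
rewrite natrM natrX -mulrA -exprMn mulrCA; apply: ler_wpM2l => //.
apply: le_trans (_ : (2 * p * p ^ v)%:R <= _).
  rewrite natrM -lp natrX; apply: ler_wpM2l => //.
  by apply: lerXn2r => //; rewrite nnegrE ?mulr_ge0 ?ler0n.
rewrite ler_nat; apply: leq_trans (ffact_ge vp) _.
by rewrite -lp; have := @card_pattern_ge l l.+1 _ u0; rewrite u0q vE.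
Qed.

End TraceComparison.
(** * The norm of the comparison matrix *)

Section CauchySchwarz.
Variables (R : realType) (I : finType).

(** Lagrange's identity. *)
Lemma sum_cauchy_schwarz (a b : I -> R) :
  (\sum_i a i * b i) ^+ 2 <= (\sum_i a i ^+ 2) * (\sum_i b i ^+ 2).
Proof.
have : 0 <= \sum_i \sum_j (a i * b j - a j * b i) ^+ 2.
  by apply: sumr_ge0 => i _; apply: sumr_ge0 => j _; exact: sqr_ge0.
have -> : \sum_i \sum_j (a i * b j - a j * b i) ^+ 2 =
   (\sum_i a i ^+ 2) * (\sum_i b i ^+ 2) + (\sum_i b i ^+ 2) * (\sum_i a i ^+ 2)
   - 2 * (\sum_i a i * b i) ^+ 2.
  have -> : 2 * (\sum_i a i * b i) ^+ 2 = \sum_i \sum_j 2 * ((a i * b i) * (a j * b j)).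
    rewrite expr2 big_distrlr big_distrr /=; apply: eq_bigr => i _.
    by rewrite big_distrr.
  rewrite !big_distrlr /= -big_split -sumrB /=; apply: eq_bigr => i _.
  by rewrite -big_split -sumrB /=; apply: eq_bigr => j _; ring.
lra.
Qed.

Lemma sum_sqr_card (P : pred I) (a : I -> R) :
  (\sum_(i | P i) a i) ^+ 2 <= #|P|%:R * \sum_(i | P i) a i ^+ 2.
Proof.
have := sum_cauchy_schwarz (fun i => (P i)%:R) (fun i => (P i)%:R * a i).
have -> : \sum_i (P i)%:R * ((P i)%:R * a i) = \sum_(i | P i) a i.
  by rewrite [RHS]big_mkcond; apply: eq_bigr => i _; case: (P i); rewrite ?mul1r ?mul0r.
have -> : \sum_i ((P i)%:R : R) ^+ 2 = #|P|%:R.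
  rewrite -sum1_card natr_sum [RHS]big_mkcond; apply: eq_bigr => i _.
  by rewrite unfold_in; case: (P i); rewrite ?expr1n ?expr0n.
have -> // : \sum_i ((P i)%:R * a i) ^+ 2 = \sum_(i | P i) a i ^+ 2.
rewrite [RHS]big_mkcond; apply: eq_bigr => i _.
by case: (P i); rewrite ?mul1r ?mul0r ?expr0n.
Qed.

End CauchySchwarz.

(** * Exponential moments of the comparison matrix *)

Section SkewMgf.
Variable R : realType.

(** After multiplication by [1 - a], which is at most [expR (- a)], the claim becomes
    [1 <= 1 + a ^+ 2 * (1 - 2 * a)]. *)
Lemma expR_le_quadratic (a : R) : -1/2 <= a -> a <= 1/2 -> expR a <= 1 + a + 2 * a ^+ 2.
Proof.
move=> ha hb; rewrite -(ler_pM2r (_ : 0 < 1 - a)); last lra.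
apply: le_trans (_ : 1 <= _); last by rewrite expr2; nra.
by rewrite -[leRHS](expRxMexpNx_1 a); apply: ler_wpM2l; [exact: expR_ge0|exact: expR_ge1Dx].
Qed.

(** The linear term stands apart because it averages to 0 under a centered law, leaving a purely
    Gaussian bound. *)
Lemma expR_le_subgaussian (a : R) : expR a <= a + expR (2 * a ^+ 2).
Proof.
have h1 : 1 + 2 * a ^+ 2 <= expR (2 * a ^+ 2) by exact: expR_ge1Dx.
have a2 := sqr_ge0 a.
have [ha|ha] := ltP (1/2) a.
  apply: le_trans (_ : expR (2 * a ^+ 2) <= _); last lra.
  by rewrite ler_expR expr2; nra.
have [hb|hb] := ltP a (-1/2).
  have : expR a <= 1 by rewrite expR_le1; lra.
  nra.
have := expR_le_quadratic hb ha; lra.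
Qed.

Lemma skew_mgf (s : R) :
  1/3 * expR (s * skew R true) + (1 - 1/3) * expR (s * skew R false) <= expR (8 * s ^+ 2).
Proof.
rewrite /skew; have h1 := expR_le_subgaussian (s * 2).
have h2 := expR_le_subgaussian (s * -1).
have h3 : expR (2 * (s * -1) ^+ 2) <= expR (8 * s ^+ 2).
  by rewrite ler_expR exprMn sqrrN expr1n mulr1; have := sqr_ge0 s; lra.
have h4 : 2 * (s * 2) ^+ 2 = 8 * s ^+ 2 by ring.
rewrite h4 in h1; lra.
Qed.

Definition bilin n (B : 'M[R]_n) (x z : 'I_n -> R) : R := \sum_i \sum_j x i * B i j * z j.

Lemma bilinZ n (B : 'M[R]_n) (a b : R) x z :
  bilin B (fun i => a * x i) (fun i => b * z i) = a * b * bilin B x z.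
Proof.
rewrite /bilin big_distrr; apply: eq_bigr => i _ /=; rewrite big_distrr.
by apply: eq_bigr => j _ /=; ring.
Qed.

Lemma edge_mx_bilin n (v : bool -> R) (G : {set {set 'I_n}}) x z :
  bilin (edge_mx (fun=> v) G) x z =
  \sum_(e : {set 'I_n}) v (e \in G) *
     \sum_(p : 'I_n * 'I_n | [set p.1; p.2] == e) x p.1 * z p.2.
Proof.
rewrite /bilin pair_bigA /=.
rewrite (partition_big (fun p : 'I_n * 'I_n => [set p.1; p.2]) predT) //=.
apply: eq_bigr => e _; rewrite big_distrr /=; apply: eq_bigr => p /eqP pe.
by rewrite mxE pe; ring.
Qed.

Lemma card_edge_pairs n (e : {set 'I_n}) :
  (#|[pred p : 'I_n * 'I_n | [set p.1; p.2] == e]| <= 2)%N.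
Proof.
have [/existsP[[a b] /eqP <-]|] := boolP [exists p : 'I_n * 'I_n, [set p.1; p.2] == e]; last first.
  rewrite negb_exists => /forallP h; rewrite eq_card0 // => p.
  by rewrite inE (negPf (h p)).
apply: leq_trans (_ : #|[set (a, b); (b, a)]| <= 2)%N; last by rewrite cards2; case: eqP.
apply: subset_leq_card; apply/fintype.subsetP => -[c d]; rewrite !inE /= => /eqP E.
have := finset.in_setT c; move: (E) => /setP/(_ c); move: (E) => /setP/(_ d).
move/setP: E => E; have := E a; have := E b; rewrite !inE !eqxx /= ?orbT !xpair_eqE => h1 h2 h3 h4 _.
move: h3 h4 => /esym/orP[/eqP ?|/eqP ?] /esym/orP[/eqP ?|/eqP ?]; subst; rewrite ?eqxx ?orbT //.
  by move: h1; rewrite orbb => /eqP ->; rewrite eqxx.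
by move: h2; rewrite orbb => /eqP ->; rewrite eqxx.
Qed.

(** At most two ordered pairs share an edge, so the squared coefficient of an edge is at most twice
    the sum of squares over its pairs; this doubles the 8 of [skew_mgf]. *)
Lemma skew_bilin_mgf n (x z : 'I_n -> R) :
  bits_E (fun=> 1/3) (fun G => expR (bilin (edge_mx (fun=> @skew R) G) x z)) <=
  expR (16 * (\sum_i x i ^+ 2) * (\sum_i z i ^+ 2)).
Proof.
pose coef (e : {set 'I_n}) := \sum_(p : 'I_n * 'I_n | [set p.1; p.2] == e) x p.1 * z p.2.
have -> : bits_E (fun=> 1/3) (fun G => expR (bilin (edge_mx (fun=> @skew R) G) x z)) =
  \prod_e (1/3 * expR (coef e * skew R true) + (1 - 1/3) * expR (coef e * skew R false)).
  rewrite -(bits_E_prod (fun=> 1/3) (fun e b => expR (coef e * skew R b))).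
  apply: eq_bits_E => G; rewrite edge_mx_bilin expR_sum.
  by apply: eq_bigr => e _; rewrite mulrC.
apply: le_trans (_ : \prod_e expR (8 * coef e ^+ 2) <= _).
  apply: ler_prod => e _; rewrite skew_mgf andbT.
  by apply: addr_ge0; apply: mulr_ge0; rewrite ?expR_ge0 //; lra.
rewrite -expR_sum ler_expR -big_distrr /=.
have -> : 16 * (\sum_i x i ^+ 2) * (\sum_i z i ^+ 2) =
   8 * \sum_(e : {set 'I_n}) 2 * \sum_(p : 'I_n * 'I_n | [set p.1; p.2] == e) (x p.1 * z p.2) ^+ 2.
  rewrite -big_distrr /= mulrA -mulrA; congr (_ * _); first by rewrite -natrM.
  rewrite big_distrlr /= pair_bigA /=.
  rewrite (partition_big (fun p : 'I_n * 'I_n => [set p.1; p.2]) predT) //=.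
  by apply: eq_bigr => e _; apply: eq_bigr => p _; rewrite exprMn.
apply: ler_wpM2l => //; apply: ler_sum => e _.
apply: le_trans (sum_sqr_card _ _) _; apply: ler_wpM2r.
  by apply: sumr_ge0 => p _; exact: sqr_ge0.
by rewrite ler_nat card_edge_pairs.
Qed.

End SkewMgf.

(** * Maximizing a bilinear form over lattice points *)

Section LatticeBall.
Variables (R : realType) (l : nat).
Local Notation r := l.+1.

(* Coordinates range over the integers of [-2r, 2r], shifted to be ordinals. *)
Definition lattice_vec (f : {ffun 'I_r -> 'I_(4 * r).+1}) (i : 'I_r) : R :=
  (f i)%:R - (2 * r)%:R.

(** A vector of squared norm at most [r], moved by at most 1 in each coordinate, has squared norm at
    most [2 * r + 2 * r]; hence [4 * r]. *)
Definition lattice_ball : {set {ffun 'I_r -> 'I_(4 * r).+1}} :=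
  [set f | \sum_i lattice_vec f i ^+ 2 <= (4 * r)%:R].

(** With truncated subtraction the exponent is the distance from [j] to the centre [N]. *)
Lemma sum_two_sided_geometric N :
  \sum_(j < (2 * N).+1) (2^-1 : R) ^+ (j - N + (N - j)) <= 3.
Proof.
suff -> : \sum_(j < (2 * N).+1) (2^-1 : R) ^+ (j - N + (N - j)) = 3 - 2 * 2^-1 ^+ N.
  by rewrite lerBlDr lerDl mulr_ge0 // exprn_ge0 // invr_ge0.
elim: N => [|N IH]; first by rewrite big_ord1 subnn !expr0; ring.
have -> : (2 * N.+1 = (2 * N).+2)%N by lia.
rewrite big_ord_recl big_ord_recr /=.
under eq_bigr do rewrite /bump /= add1n !subSS.
rewrite IH /bump /= !add1n sub0n !subSS !subn0 add0n.
have -> : ((2 * N).+1 - N + (N - (2 * N).+1) = N.+1)%N by lia.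
by rewrite !exprS; field.
Qed.

(* 1 <= 2^(4r - sum_i |f_i|) on the ball, and this weight is a product over the
   coordinates. *)
Lemma card_lattice_ball : (#|lattice_ball|%:R : R) <= 48 ^+ r.
Proof.
pose dist (j : nat) := (j - 2 * r + (2 * r - j))%N.
have dist_le (f : {ffun 'I_r -> 'I_(4 * r).+1}) i : (dist (f i))%:R <= lattice_vec f i ^+ 2.
  have -> : lattice_vec f i ^+ 2 = ((dist (f i)) ^ 2)%:R.
    rewrite /lattice_vec /dist natrX.
    case: (leqP (2 * r) (f i)) => h.
      by rewrite (eqP (_ : _ - f i == 0)%N) ?subn_eq0 // addn0 natrB.
    have /eqP -> : (f i - 2 * r == 0)%N by rewrite subn_eq0 ltnW.
    by rewrite add0n natrB ?(ltnW h) // -sqrrN opprB.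
  by rewrite ler_nat; case: (dist _) => // d; rewrite -{1}[d.+1]expn1 leq_pexp2l.
pose wt (j : nat) : R := 2^-1 ^+ dist j.
have h2 : 0 <= (2^-1 : R) by rewrite invr_ge0.
apply: le_trans (_ : \sum_(f : {ffun 'I_r -> 'I_(4 * r).+1}) 16 ^+ r * \prod_i wt (f i) <= _).
  rewrite -sum1_card natr_sum big_mkcond /=; apply: ler_sum => f _; rewrite inE.
  have p0 : 0 <= 16 ^+ r * \prod_i wt (f i).
    by rewrite mulr_ge0 ?exprn_ge0 // prodr_ge0 // => i _; exact: exprn_ge0.
  case: ifP => // fT; rewrite /wt -(big_morph _ (exprD _) (expr0 _)).
  have : (\sum_i dist (f i) <= 4 * r)%N.
    rewrite -(ler_nat R) natr_sum; apply: le_trans fT.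
    by apply: ler_sum => i _; exact: dist_le.
  move=> h; have -> : (16 : R) ^+ r = 2 ^+ (4 * r) by rewrite exprM; congr (_ ^+ _); ring.
  rewrite exprVn ler_pdivlMr ?exprn_gt0 // mul1r.
  by apply: ler_weXn2l => //; lra.
rewrite -big_distrr /= -(bigA_distr_bigA (fun (i : 'I_r) (j : 'I_(4 * r).+1) => wt j)) /=.
have -> : (48 : R) = 16 * 3 by ring.
rewrite exprMn; apply: ler_wpM2l; first by rewrite exprn_ge0.
rewrite -[r in leRHS]card_ord -prodr_const; apply: ler_prod => i _.
rewrite sumr_ge0 => [|j _]; last exact: exprn_ge0.
by have := sum_two_sided_geometric (2 * r); rewrite mulnA.
Qed.

(* Rounding every coordinate towards the sign of y never decreases the pairing, so
   no approximation error has to be absorbed, unlike with an epsilon-net. *)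
Lemma lattice_round (x y : 'I_r -> R) : \sum_i x i ^+ 2 <= r%:R ->
  exists2 f, f \in lattice_ball & \sum_i x i * y i <= \sum_i lattice_vec f i * y i.
Proof.
move=> xr; pose c i : int := if 0 <= y i then Num.floor (x i) + 1 else Num.floor (x i).
have xf i := floor_itv (x i).
have c2 i : (c i)%:~R ^+ 2 <= 2 * x i ^+ 2 + 2.
  have within1 (w : R) : `|w - x i| <= 1 -> w ^+ 2 <= 2 * x i ^+ 2 + 2.
    move=> h; have : (w - x i) ^+ 2 <= 1 by rewrite -real_normK ?num_real // exprn_ile1.
    have := sqr_ge0 (2 * x i - w); rewrite !expr2; lra.
  have /andP[h1 h2] := xf i; apply: within1; rewrite ler_norml.
  by move: h1 h2; rewrite /c; case: ifP => _; rewrite ?intrD ?mulr1z; lra.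
have cs : \sum_i ((c i)%:~R : R) ^+ 2 <= (4 * r)%:R.
  apply: le_trans (_ : \sum_i (2 * x i ^+ 2 + 2) <= _); first exact: ler_sum.
  rewrite big_split /= -big_distrr /= sumr_const card_ord -[X in _ + X]mulr_natr natrM.
  by move: xr; lra.
have cb i : (`|c i|%N <= 2 * r)%N.
  have : (`|c i|%N ^ 2 <= 4 * r)%N.
    rewrite -(ler_nat R) natrX -[`|c i|%N%:R]/(`|c i|%N%:~R) abszE intr_norm.
    rewrite real_normK ?num_real //; apply: le_trans cs.
    rewrite (bigD1 i) //= lerDl; apply: sumr_ge0 => j _; exact: sqr_ge0.
  by rewrite -mulnn; nia.
have fb i : (absz (c i + (2 * r)%:Z)%R < (4 * r).+1)%N by have := cb i; lia.
exists [ffun i => Ordinal (fb i)]; last first.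
  apply: ler_sum => i _; rewrite /lattice_vec ffunE /=.
  have -> : (absz (c i + (2 * r)%:Z)%R)%:R - (2 * r)%:R = (c i)%:~R :> R.
    rewrite -[(absz _)%:R]/((absz _)%:~R) abszE ger0_norm ?intrD ?addrK //.
    by have := cb i; lia.
  have /andP[h1 h2] := xf i; rewrite /c; case: ifP => [y0|/negbT].
    by apply: ler_wpM2r => //; exact: ltW.
  by rewrite -ltNge => y0; rewrite ler_nM2r.
rewrite inE; apply: le_trans cs; rewrite le_eqVlt; apply/orP; left; apply/eqP.
apply: eq_bigr => i _; congr (_ ^+ 2); rewrite /lattice_vec ffunE /=.
rewrite -[(absz _)%:R]/((absz _)%:~R) abszE ger0_norm ?intrD ?addrK //.
by have := cb i; lia.
Qed.

(** For fixed [z] the form is linear in [x], so [x] can be rounded first and then [z], without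
    decreasing the value. *)
Lemma bilin_le_lattice (B : 'M[R]_r) K :
  (forall f g, f \in lattice_ball -> g \in lattice_ball ->
     bilin B (lattice_vec f) (lattice_vec g) <= K) ->
  forall x z : 'I_r -> R, \sum_i x i ^+ 2 <= r%:R -> \sum_i z i ^+ 2 <= r%:R ->
  bilin B x z <= K.
Proof.
move=> BK x z xr zr.
have [f fT fle] := lattice_round (fun i => \sum_j B i j * z j) xr.
have [g gT gle] := lattice_round (fun j => \sum_i lattice_vec f i * B i j) zr.
apply: le_trans (BK f g fT gT).
apply: le_trans (_ : \sum_i x i * \sum_j B i j * z j <= _).
  rewrite le_eqVlt; apply/orP; left; apply/eqP; apply: eq_bigr => i _.
  by rewrite big_distrr; apply: eq_bigr => j _ /=; rewrite mulrA.
apply: le_trans fle _.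
have -> : \sum_i lattice_vec f i * \sum_j B i j * z j =
  \sum_j z j * \sum_i lattice_vec f i * B i j.
  under eq_bigr do rewrite big_distrr /=.
  rewrite exchange_big; apply: eq_bigr => j _; rewrite big_distrr.
  by apply: eq_bigr => i _ /=; ring.
apply: le_trans gle _; rewrite le_eqVlt; apply/orP; left; apply/eqP.
rewrite [RHS]exchange_big; apply: eq_bigr => j _; rewrite big_distrr.
by apply: eq_bigr => i _ /=; ring.
Qed.

End LatticeBall.

(** * Traces of even powers and operator norms *)

Section EvenTraces.
Variable R : realType.

Definition frob_sq n (B : 'M[R]_n) : R := \sum_i \sum_j B i j ^+ 2.

Lemma trmx_pow n (B : 'M[R]_n) p : B^T = B -> (B ^+ p)^T = B ^+ p.
Proof.
move=> sB; elim: p => [|p IH]; first by rewrite expr0 trmx1.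
by rewrite [RHS]exprSr exprS trmx_mul IH sB.
Qed.

Lemma mxtrace_even n (B : 'M[R]_n) p q : q = (2 * p)%N -> B^T = B ->
  \tr (B ^+ q) = frob_sq (B ^+ p).
Proof.
move=> -> sB; rewrite mul2n -addnn exprD; apply: eq_bigr => i _.
rewrite mxE; apply: eq_bigr => j _.
by rewrite expr2; congr (_ * _); rewrite -[in LHS](trmx_pow p sB) mxE.
Qed.

Lemma frob_sq_ge0 n (B : 'M[R]_n) : 0 <= frob_sq B.
Proof. by apply: sumr_ge0 => i _; apply: sumr_ge0 => j _; exact: sqr_ge0. Qed.

(** [K] is a bound for the squared operator norm. Each further factor [B], acting on columns, costs
    at most [K], starting from the identity with [n] unit entries. *)
Lemma frob_sq_pow n (B : 'M[R]_n) (K : R) p :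
  (forall z, \sum_i (\sum_j B i j * z j) ^+ 2 <= K * \sum_i z i ^+ 2) -> 0 <= K ->
  frob_sq (B ^+ p) <= K ^+ p * n%:R.
Proof.
move=> BK K0; elim: p => [|p IH].
  rewrite !expr0 mul1r -[n in leRHS]card_ord -sum1_card natr_sum.
  apply: ler_sum => i _; rewrite (bigD1 i) //= big1 => [|j ji].
    by rewrite mxE eqxx expr1n addr0.
  by rewrite mxE eq_sym (negPf ji) expr0n.
rewrite exprS [K ^+ _]exprS -mulrA; apply: le_trans (ler_wpM2l K0 IH).
rewrite /frob_sq exchange_big [in leRHS]exchange_big big_distrr /=.
apply: ler_sum => j _.
apply: le_trans (BK (fun i => (B ^+ p) i j)).
by apply: ler_sum => i _; rewrite mxE.
Qed.

(** Tested at [B z] and [z], both rescaled to squared norm [r]; the value is then a multiple of the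
    squared norm of [B z]. *)
Lemma bilin_opnorm n (B : 'M[R]_n) (r K : R) : 0 < r -> 0 <= K ->
  (forall x z : 'I_n -> R, \sum_i x i ^+ 2 <= r -> \sum_i z i ^+ 2 <= r -> bilin B x z <= K) ->
  forall z, \sum_i (\sum_j B i j * z j) ^+ 2 <= (K / r) ^+ 2 * \sum_i z i ^+ 2.
Proof.
move=> r0 K0 BK z; set y := fun i => \sum_j B i j * z j.
set a := \sum_i z i ^+ 2; set b := \sum_i _.
have a0 : 0 <= a by apply: sumr_ge0 => i _; exact: sqr_ge0.
have b0 : 0 <= b by apply: sumr_ge0 => i _; exact: sqr_ge0.
have [bz|bp] := eqVneq b 0; first by rewrite bz mulr_ge0 ?sqr_ge0.
have {}bp : 0 < b by rewrite lt_neqAle eq_sym bp.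
have [az|ap] := eqVneq a 0.
  move/eqP: az; rewrite psumr_eq0 => [/allP az|i _]; last exact: sqr_ge0.
  have z0 i : z i = 0 by apply/eqP; rewrite -sqrf_eq0; apply: (implyP (az i _)); rewrite ?mem_index_enum.
  by move: bp; rewrite /b big1 ?ltxx // => i _; rewrite big1 ?expr0n // => j _; rewrite z0 mulr0.
have {}ap : 0 < a by rewrite lt_neqAle eq_sym ap.
have byz : bilin B y z = b.
  rewrite /bilin /b; apply: eq_bigr => i _; rewrite expr2 {1}/y [in RHS]big_distrr /=.
  by apply: eq_bigr => j _; rewrite mulrA.
have scaled (c : R) (v : 'I_n -> R) : 0 < c -> \sum_i v i ^+ 2 = c ->
    \sum_i (Num.sqrt (r / c) * v i) ^+ 2 <= r.
  move=> c0 vc; under eq_bigr do rewrite exprMn sqr_sqrtr ?divr_ge0 ?ltW //.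
  by rewrite -big_distrr /= vc divfK // gt_eqF.
have h := BK _ _ (scaled b y bp erefl) (scaled a z ap erefl).
have b1 : b != 0 by rewrite gt_eqF.
have a1 : a != 0 by rewrite gt_eqF.
have r1 : r != 0 by rewrite gt_eqF.
rewrite bilinZ byz in h.
have {}h : b * (r ^+ 2 / a) <= K ^+ 2.
  have -> : b * (r ^+ 2 / a) = (Num.sqrt (r / b) * Num.sqrt (r / a) * b) ^+ 2.
    by rewrite !exprMn !sqr_sqrtr ?divr_ge0 ?(ltW r0) //; field; rewrite a1 b1.
  by apply: lerXn2r; rewrite // nnegrE !mulr_ge0 // sqrtr_ge0.
rewrite -(ler_pM2r (_ : 0 < r ^+ 2 / a)) ?divr_gt0 ?exprn_gt0 //.
apply: le_trans h _; rewrite le_eqVlt; apply/orP; left; apply/eqP.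
by field; rewrite a1 r1.
Qed.

End EvenTraces.

Section SkewTrace.
Variable R : realType.

Lemma edge_mx_sym n (v : {set 'I_n} -> bool -> R) G : (edge_mx v G)^T = edge_mx v G.
Proof. by apply/matrixP => i j; rewrite !mxE finset.setUC. Qed.

Lemma exprn_le_expR (a : R) n : 0 <= a -> a ^+ n <= (n ^ n)%:R * expR a.
Proof.
move=> a0; case: n => [|n]; first by rewrite expr0 mul1r -expR0 ler_expR.
have := expR_ge1Dxn n a0 => h.
have f0 : 0 < (n.+1`!)%:R :> R by rewrite ltr0n fact_gt0.
have {h} : a ^+ n.+1 <= (n.+1`!)%:R * expR a.
  by rewrite mulrC -ler_pdivrMr //; apply: le_trans h; rewrite lerDr.
move/le_trans; apply; apply: ler_wpM2r; rewrite ?expR_ge0 // ler_nat.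
rewrite fact_prod big_add1 /= big_mkord -[X in (_ ^ X)%N]card_ord -prod_nat_const.
by apply: leq_prod => i _; exact: ltn_ord.
Qed.

(** [S] sums exponentials over pairs of lattice points and so plays the part of a union bound. Its
    expectation is at most [48 ^+ 2] per coordinate for the pairs, times [expR 256] per coordinate,
    as scaling one vector by [s^-1] leaves the exponent [16 * 4 * (4 * r)]. *)
Lemma skew_trace_le l p : l.+1 = (2 * p)%N ->
  bits_E (fun=> 1/3) (fun G => \tr (edge_mx (n := l.+1) (fun=> @skew R) G ^+ l.+1)) <=
  l.+1%:R * (Num.sqrt l.+1%:R * (48 ^+ 2 * expR 256)) ^+ l.+1.
Proof.
move=> lp; pose T := lattice_ball R l; pose s := Num.sqrt (l.+1%:R : R).
have s0 : 0 < s by rewrite sqrtr_gt0 ltr0n.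
have ss : s * s = l.+1%:R by rewrite -expr2 sqr_sqrtr.
pose Y G := edge_mx (n := l.+1) (fun=> @skew R) G.
pose S (G : {set {set 'I_l.+1}}) := \sum_(f in T) \sum_(g in T)
  expR (bilin (Y G) (fun i => s^-1 * lattice_vec R f i) (lattice_vec R g)).
have pr01 (e : {set 'I_l.+1}) : 0 <= (1/3 : R) <= 1 by lra.
have ES : bits_E (fun=> 1/3) S <= ((48 ^+ 2 * expR 256) ^+ l.+1).
  rewrite exprMn -exprM mulnC exprM -expRM_natl.
  rewrite bits_E_sum; apply: le_trans (_ : \sum_(f in T) \sum_(g in T) expR (l.+1%:R * 256) <= _).
    apply: ler_sum => f fT; rewrite bits_E_sum; apply: ler_sum => g gT.
    apply: le_trans (skew_bilin_mgf _ _) _; rewrite ler_expR.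
    move: fT gT; rewrite !inE => fT gT.
    under eq_bigr do rewrite exprMn; rewrite -big_distrr /=.
    apply: le_trans (_ : 16 * (s^-1 ^+ 2 * (4 * l.+1)%:R) * (4 * l.+1)%:R <= _).
      apply: ler_pM => //.
        by apply: mulr_ge0 => //; apply: mulr_ge0; rewrite ?sqr_ge0 // sumr_ge0 // => i _; exact: sqr_ge0.
        by rewrite sumr_ge0 // => i _; exact: sqr_ge0.
      by rewrite ler_wpM2l // ler_wpM2l // sqr_ge0.
    have -> : s^-1 ^+ 2 = l.+1%:R^-1 by rewrite exprVn expr2 ss.
    have r0 : l.+1%:R != 0 :> R by rewrite pnatr_eq0.
    rewrite natrM le_eqVlt; apply/orP; left; apply/eqP.
    by move: (l.+1%:R) r0 => r r0; field.
  rewrite !sumr_const -mulrnA -[leLHS]mulr_natl natrM -expr2.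
  apply: ler_wpM2r; first exact: expR_ge0.
  by apply: lerXn2r; rewrite ?nnegrE ?exprn_ge0 ?card_lattice_ball.
apply: le_trans (_ : bits_E (fun=> 1/3) (fun G => l.+1%:R * s ^+ l.+1 * S G) <= _); last first.
  rewrite bits_EZ -/s [(s * _) ^+ _]exprMn mulrA; apply: ler_wpM2l => //.
  by rewrite mulr_ge0 // exprn_ge0 // ltW.
apply: ler_bits_E => // G.
(* The norm is at most ln (S G) / s, and (ln S)^r <= r^r S. *)
have S_ge f g : f \in T -> g \in T ->
    expR (bilin (Y G) (fun i => s^-1 * lattice_vec R f i) (lattice_vec R g)) <= S G.
  move=> fT gT; rewrite /S (bigD1 f) //= (bigD1 g) //= -addrA lerDl addr_ge0 //.
    by apply: sumr_ge0 => *; exact: expR_ge0.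
  by apply: sumr_ge0 => *; apply: sumr_ge0 => *; exact: expR_ge0.
have z0 : \sum_(i < l.+1) (0 : R) ^+ 2 <= l.+1%:R by rewrite big1 // => i _; rewrite expr0n.
have Sp : 0 < S G.
  have [f fT _] := lattice_round (fun=> 0) z0.
  by apply: lt_le_trans (S_ge f f fT fT); exact: expR_gt0.
have lat_le f g : f \in T -> g \in T -> bilin (Y G) (lattice_vec R f) (lattice_vec R g) <= s * ln (S G).
  move=> fT gT; rewrite -ler_pdivrMl // -[leLHS]expRK ler_ln ?posrE ?expR_gt0 //.
  have := bilinZ (Y G) s^-1 1 (lattice_vec R f) (lattice_vec R g).
  rewrite mulr1 => <-; apply: le_trans (S_ge f g fT gT).
  by under [X in bilin _ _ X]funext do rewrite mul1r.
have bl := bilin_le_lattice lat_le.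
have K0 : 0 <= s * ln (S G).
  have := bl _ _ z0 z0; rewrite /bilin big1 // => i _; rewrite big1 // => j _.
  by rewrite !mul0r.
have op := bilin_opnorm (ltr0Sn R l) K0 bl.
have lS0 : 0 <= ln (S G) by rewrite -(pmulr_rge0 _ s0).
rewrite (mxtrace_even lp) ?edge_mx_sym // -/(Y G).
apply: le_trans (frob_sq_pow p op (sqr_ge0 _)) _.
rewrite mulrC -mulrA; apply: ler_wpM2l => //.
have -> : s * ln (S G) / l.+1%:R = s^-1 * ln (S G).
  by rewrite -ss; field; rewrite gt_eqF.
rewrite -exprM -lp exprMn exprVn ler_pdivrMl ?exprn_gt0 //.
apply: le_trans (exprn_le_expR _ lS0) _.
by rewrite lnK ?posrE // natrX -ss exprMn mulrA.
Qed.

End SkewTrace.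

(** * From traces to quadratic forms *)

Section Spectral.
Variable R : realType.

Lemma sum_mulmx_sq n (B : 'M[R]_n) (x : 'I_n -> R) : B^T = B ->
  \sum_i (\sum_j B i j * x j) ^+ 2 = bilin (B * B) x x.
Proof.
move=> sB; rewrite /bilin.
transitivity (\sum_i \sum_j \sum_k x j * (B j i * B i k) * x k).
  apply: eq_bigr => i _; rewrite expr2 big_distrlr /=.
  apply: eq_bigr => j _; apply: eq_bigr => k _.
  have -> : B j i = B i j by rewrite -{1}sB mxE.
  ring.
rewrite exchange_big; apply: eq_bigr => j _ /=.
rewrite exchange_big; apply: eq_bigr => k _ /=.
by rewrite mxE big_distrr big_distrl.
Qed.

Lemma bilin_sq_le n (B : 'M[R]_n) (x : 'I_n -> R) : B^T = B ->
  bilin B x x ^+ 2 <= (\sum_i x i ^+ 2) * bilin (B * B) x x.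
Proof.
move=> sB; rewrite -(sum_mulmx_sq x sB).
have -> : bilin B x x = \sum_i x i * (\sum_j B i j * x j).
  apply: eq_bigr => i _; rewrite big_distrr; apply: eq_bigr => j _ /=.
  by rewrite mulrA.
exact: sum_cauchy_schwarz.
Qed.

(** Cauchy-Schwarz bounds the squared form of [B] by that of [B * B]; the induction applies this to
    [B * B] in turn, doubling the exponent. *)
Lemma bilin_pow_le n k (B : 'M[R]_n) (x : 'I_n -> R) : B^T = B ->
  bilin B x x ^+ (2 ^ k) <= (\sum_i x i ^+ 2) ^+ (2 ^ k).-1 * bilin (B ^+ (2 ^ k)) x x.
Proof.
set s := \sum_i _; have s0 : 0 <= s by apply: sumr_ge0 => i _; exact: sqr_ge0.
elim: k B => [|k IH] B sB; first by rewrite !expr1 expr0 mul1r.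
have sBB : (B * B)^T = B * B by rewrite trmx_mul sB.
have p0 : 0 <= bilin (B * B) x x.
  by rewrite -(sum_mulmx_sq x sB) sumr_ge0 // => i _; exact: sqr_ge0.
rewrite expnS exprM; apply: le_trans (_ : (s * bilin (B * B) x x) ^+ (2 ^ k) <= _).
  by apply: lerXn2r; rewrite ?nnegrE ?sqr_ge0 ?mulr_ge0 // bilin_sq_le.
rewrite exprMn; apply: le_trans (ler_wpM2l _ (IH _ sBB)) _; first exact: exprn_ge0.
rewrite mulrA -exprD exprM expr2.
suff -> : (2 ^ k + (2 ^ k).-1 = (2 * 2 ^ k).-1)%N by [].
by have := expn_gt0 2 k; lia.
Qed.

(** For [D = B ^+ (2 ^ k)] the form of [D * D] at [x] is the squared norm of [D x], at most the
    squared Frobenius norm of [D], which is the trace, times that of [x]. *)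
Lemma bilin_le_trace n k (B : 'M[R]_n) (N : R) : B^T = B -> 0 <= N ->
  \tr (B ^+ (2 ^ k.+1)) <= N ^+ (2 ^ k.+1) ->
  forall x, bilin B x x <= N * \sum_i x i ^+ 2.
Proof.
move=> sB N0 trN x; set s := \sum_i _.
have s0 : 0 <= s by apply: sumr_ge0 => i _; exact: sqr_ge0.
have [b0|b0] := ltP (bilin B x x) 0.
  by apply: le_trans (ltW b0) _; rewrite mulr_ge0.
rewrite -(ler_pXn2r (expn_gt0 2 k.+1 : (0 < 2 ^ k.+1)%N)) ?nnegrE ?mulr_ge0 //.
apply: le_trans (bilin_pow_le k.+1 x sB) _; rewrite -/s.
have sq : bilin (B ^+ (2 ^ k.+1)) x x <= \tr (B ^+ (2 ^ k.+1)) * s.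
  have sD := trmx_pow (2 ^ k) sB.
  rewrite (mxtrace_even (expnS 2 k) sB) {1}expnS mulnC exprM expr2 -sum_mulmx_sq //.
  rewrite /frob_sq big_distrl /=; apply: ler_sum => i _.
  exact: sum_cauchy_schwarz.
apply: le_trans (ler_wpM2l _ sq) _; first exact: exprn_ge0.
rewrite mulrCA -exprSr prednK ?expn_gt0 // exprMn.
by apply: ler_wpM2r; rewrite ?exprn_ge0.
Qed.

Lemma dyadic_between (d : R) : 1 <= d -> exists k, d <= (2 ^ k)%:R <= 2 * d.
Proof.
move=> d1; have ex : exists k, d <= (2 ^ k)%:R.
  have d0 : 0 <= d by apply: le_trans d1.
  exists (Num.bound d); have := archi_boundP d0 => h; apply: ltW; apply: lt_le_trans h _.
  by rewrite ler_nat ltnW // ltn_expl.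
exists (ex_minn ex); case: ex_minnP => -[|k] kd kmin; rewrite kd /=.
  by rewrite expn0; lra.
have : (2 ^ k)%:R < d by rewrite ltNge; apply/negP => /kmin; rewrite ltnn.
by rewrite expnS natrM => h; rewrite ler_wpM2l // ltW.
Qed.

(** The 2 pays for rounding the exponent up to a power of two, [expR 1] for Markov's inequality; the
    rest comes from [skew_trace_le]. *)
Definition spectral_const : R := 2 * expR 1 * (48 ^+ 2 * expR 256).

Lemma spectral_const_gt0 : 0 < spectral_const.
Proof. by rewrite !mulr_gt0 ?expR_gt0 // exprn_gt0. Qed.

(** [F] is the trace divided by [N ^+ r], where [N] exceeds the bound on the [r]-th root scale by
    [expR 1]. This gives [expR (- r)], and [r >= 2 * d]. A function rather than an event is returned
    so that failure terms can be added. *)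
Lemma centered_spectral_bound n (C : eqType) (tau : 'I_n -> C) (w : nat)
    (pr : {set 'I_n} -> R) (D : {set {set 'I_n}}) (rho d : R) :
  0 <= rho <= 1 -> 1 <= d -> w%:R * rho <= d ->
  (forall e, 0 <= pr e <= 1) -> (forall e, e \in D -> pr e <= rho) ->
  (forall x y, tau x != tau y -> [set x; y] \notin D) ->
  (forall x, #|[pred y | tau y == tau x]| <= w)%N ->
  exists F : {set {set 'I_n}} -> R,
   [/\ forall G, 0 <= F G, bits_E pr F <= n%:R * expR (- (2 * d)) &
    forall G, F G < 1 -> forall x,
      bilin (edge_mx (centered pr D) G) x x <= spectral_const * Num.sqrt d * \sum_i x i ^+ 2].
Proof.
move=> rho01 d1 wd pr01 prle Dc cw.
have [k /andP[dk kd]] := dyadic_between d1.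
have [l lE] : exists l, l.+1 = (2 ^ k.+1)%N.
  by exists (2 ^ k.+1).-1; rewrite prednK // expn_gt0.
have lp : l.+1 = (2 * 2 ^ k)%N by rewrite lE expnS.
have r0 : 0 < l.+1%:R :> R by rewrite ltr0n.
set s := Num.sqrt (l.+1%:R : R); set c0 : R := 48 ^+ 2 * expR 256.
have s0 : 0 < s by rewrite sqrtr_gt0.
have c00 : 0 < c0 by rewrite mulr_gt0 ?expR_gt0 // exprn_gt0.
pose N := expR 1 * (s * c0).
have N0 : 0 < N by rewrite !mulr_gt0 ?expR_gt0.
have EX : bits_E pr (fun G => \tr (edge_mx (centered pr D) G ^+ l.+1)) <= n%:R * (s * c0) ^+ l.+1.
  rewrite -(ler_pM2l r0) mulrCA.
  apply: le_trans (trace_comparison lp rho01 (le_trans wd dk) pr01 prle Dc cw) _.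
  by apply: ler_wpM2l => //; exact: skew_trace_le lp.
exists (fun G => (N ^+ l.+1)^-1 * \tr (edge_mx (centered pr D) G ^+ l.+1)); split.
- move=> G; apply: mulr_ge0; first by rewrite invr_ge0 exprn_ge0 // ltW.
  by rewrite (mxtrace_even lp) ?edge_mx_sym // frob_sq_ge0.
- rewrite bits_EZ ler_pdivrMl ?exprn_gt0 //; apply: le_trans EX _.
  rewrite [leRHS]mulrCA; apply: ler_wpM2l => //.
  rewrite [N ^+ _]exprMn [_ ^+ _ * _ ^+ _]mulrC -[leRHS]mulrA; apply: ler_peMr.
    by rewrite exprn_ge0 // mulr_ge0 // ltW.
  rewrite -expRM_natl mulr1 -expRD -[leLHS]expR0 ler_expR subr_ge0.
  by rewrite lp natrM ler_wpM2l.
- move=> G; rewrite ltr_pdivrMl ?exprn_gt0 // mulr1 => /ltW trN x.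
  rewrite lE in trN.
  apply: le_trans (bilin_le_trace (edge_mx_sym _ _) (ltW N0) trN x) _.
  apply: ler_wpM2r; first by apply: sumr_ge0 => i _; exact: sqr_ge0.
  have sd : s <= 2 * Num.sqrt d.
    have -> : 2 * Num.sqrt d = Num.sqrt (4 * d).
      rewrite sqrtrM // (_ : 4 = 2 ^+ 2) ?sqrtr_sqr ?ger0_norm //; ring.
    by apply: ler_wsqrtr; rewrite lp natrM; lra.
  have -> : spectral_const * Num.sqrt d = expR 1 * (2 * Num.sqrt d * c0).
    by rewrite /spectral_const -/c0; ring.
  by rewrite /N; apply: ler_wpM2l; rewrite ?expR_ge0 //; apply: ler_wpM2r => //; exact: ltW.
Qed.

End Spectral.
(** * Recovery in the stochastic block model *)

Section BlockModel.
Variable R : realType.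

(** Degrees are sums over vertices, or pairs of vertices, rather than over edges; injectivity of [h]
    ensures that each independent bit is counted once. *)
Lemma bits_mgf_inj (I J : finType) (pr : I -> R) (P : pred J) (h : J -> I) (c : J -> R) :
  (forall i, 0 <= pr i <= 1) -> {in P &, injective h} ->
  bits_E pr (fun G => expR (\sum_(j | P j) c j * (h j \in G)%:R)) <=
  expR (\sum_(j | P j) pr (h j) * (expR (c j) - 1)).
Proof.
move=> pr01 h_inj; pose w i := \sum_(j | P j && (h j == i)) c j.
have -> : \sum_(j | P j) pr (h j) * (expR (c j) - 1) = \sum_i pr i * (expR (w i) - 1).
  rewrite (partition_big h predT) //=; apply: eq_bigr => i _; rewrite /w.
  have [/existsP[j0 /andP[Pj0 /eqP <-]]|] := boolP [exists j, P j && (h j == i)].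
    have u j : P j && (h j == h j0) = (j == j0).
      apply/andP/eqP => [[Pj /eqP]|-> //]; exact: h_inj.
    by rewrite !(big_pred1 j0).
  rewrite negb_exists => /forallP h0.
  by rewrite !big_pred0 ?expR0 ?subrr ?mulr0 // => j; apply/negbTE/h0.
apply: le_trans (bits_mgf pr01 w); rewrite le_eqVlt; apply/orP; left; apply/eqP.
apply: eq_bits_E => G; congr expR.
rewrite (partition_big h predT) //= [RHS]big_mkcond /=; apply: eq_bigr => i _.
rewrite /w; case: ifP => iG.
  by apply: eq_bigr => j /andP[_ /eqP ->]; rewrite iG mulr1.
by rewrite big1 // => j /andP[_ /eqP ->]; rewrite iG mulr0.
Qed.

Variables (n k : nat) (sigma : 'I_n -> 'I_k).
Variables p q : R.
Hypotheses (p01 : 0 <= p <= 1) (q01 : 0 <= q <= 1).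

(** Bits are indexed by all vertex sets, so non-pairs must have probability 0; [edge_prob] alone
    would give a singleton probability [p]. *)
Definition pair_prob (e : {set 'I_n}) : R :=
  if e \in vpairs n then edge_prob p q sigma e else 0.

Lemma pair_sub_cluster i j :
  [exists a : 'I_k, [set i; j] \subset Defs.cluster sigma a] = (sigma i == sigma j).
Proof.
apply/existsP/eqP => [[a /fintype.subsetP h]|E].
  have := h i; have := h j; rewrite !inE !eqxx orbT => /(_ isT)/eqP -> /(_ isT)/eqP -> //.
exists (sigma i); apply/fintype.subsetP => x; rewrite !inE => /orP[]/eqP -> //.
by rewrite E.
Qed.

Lemma edge_prob_pair i j :
  edge_prob p q sigma [set i; j] = if sigma i == sigma j then p else q.
Proof. by rewrite /edge_prob pair_sub_cluster. Qed.

Lemma pair_in_vpairs (i j : 'I_n) : ([set i; j] \in vpairs n) = (i != j).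
Proof. by rewrite inE cards2; case: (i == j). Qed.

Lemma pair_prob_pair i j :
  pair_prob [set i; j] = if i == j then 0 else if sigma i == sigma j then p else q.
Proof. by rewrite /pair_prob pair_in_vpairs edge_prob_pair; case: eqP. Qed.

Lemma pair_prob01 e : 0 <= pair_prob e <= 1.
Proof.
rewrite /pair_prob /edge_prob; case: ifP => _; last by rewrite lexx ler01.
by case: ifP.
Qed.

(** Markov's inequality: [1 - F G] is pointwise at most the indicator of [Q], and graphs that are
    not simple have mass 0. *)
Lemma sbm_prob_ge (Q : {set {set 'I_n}} -> Prop) (F : {set {set 'I_n}} -> R) :
  (forall G, 0 <= F G) -> (forall G, simple_graph G -> F G < 1 -> Q G) ->
  1 - bits_E pair_prob F <= sbm_prob p q sigma Q.
Proof.
move=> F0 FQ.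
have mass0 G : ~~ simple_graph G -> bits_mass pair_prob G = 0.
  move=> /subsetPn[e eG ev]; apply/eqP; rewrite prodf_seq_eq0; apply/hasP.
  by exists e; rewrite ?mem_index_enum //= eG /pair_prob (negPf ev).
have massE G : simple_graph G -> sbm_mass p q sigma G = bits_mass pair_prob G.
  move=> /fintype.subsetP sG; rewrite /sbm_mass big_mkcond; apply: eq_bigr => e _.
  rewrite /pair_prob; case: ifP => // ev.
  by case: ifP => [/sG|_]; rewrite ?ev // subr0.
rewrite -(bits_E1 pair_prob) -[X in _ - X]mul1r -mulNr -bits_EZ -bits_ED.
rewrite /sbm_prob [leRHS]big_mkcond; apply: ler_sum => G _ /=.
have m0 := bits_mass_ge0 pair_prob01 G.
case: (boolP (simple_graph G)) => [sG|nG] /=; last by rewrite mass0 // mul0r.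
rewrite massE //; case: asboolP => [_|nQ].
  by rewrite -[leRHS]mulr1; apply: ler_wpM2l => //; have := F0 G; lra.
apply: mulr_ge0_le0 => //; rewrite mulN1r subr_le0 leNgt; apply/negP => /(FQ G sG).
exact: nQ.
Qed.

Definition inner_pairs : {set {set 'I_n}} :=
  [set e in vpairs n | [exists a : 'I_k, e \subset Defs.cluster sigma a]].
Definition outer_pairs : {set {set 'I_n}} := vpairs n :\: inner_pairs.

Lemma inner_pairsE i j : ([set i; j] \in inner_pairs) = (i != j) && (sigma i == sigma j).
Proof. by rewrite inE pair_in_vpairs pair_sub_cluster. Qed.

Lemma outer_pairsE i j : ([set i; j] \in outer_pairs) = (sigma i != sigma j).
Proof.
rewrite finset.in_setD inner_pairsE pair_in_vpairs.
have [->|ij] := eqVneq i j; first by rewrite eqxx.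
by rewrite /= andbT.
Qed.

(** The mean of the adjacency matrix is a block-constant matrix, which vanishes on such [v], minus
    [p] times the identity, which only helps. *)
Lemma adjmx_quadratic_le (G : {set {set 'I_n}}) (v : 'I_n -> R) :
  simple_graph G -> (forall a, \sum_(i | sigma i == a) v i = 0) ->
  \sum_i \sum_j v i * adjmx R G i j * v j <=
  bilin (edge_mx (centered pair_prob inner_pairs) G) v v +
  bilin (edge_mx (centered pair_prob outer_pairs) G) v v.
Proof.
move=> sG v0; have /andP[p0 _] := p01.
have -> : \sum_i \sum_j v i * adjmx R G i j * v j =
  bilin (edge_mx (centered pair_prob inner_pairs) G) v v +
  bilin (edge_mx (centered pair_prob outer_pairs) G) v v
  + \sum_i v i * (\sum_j (if sigma j == sigma i then p else q) * v j) - p * \sum_i v i ^+ 2.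
  rewrite /bilin -!big_split /= big_distrr /= -sumrB; apply: eq_bigr => i _.
  rewrite -big_split /= big_distrr /= -big_split /=.
  rewrite (bigD1 i) //= [X in _ = X - _](bigD1 i) //= [RHS]addrAC; congr (_ + _).
    have ii : [set i; i] \in G = false.
      by apply/negbTE/negP => /(fintype.subsetP sG); rewrite pair_in_vpairs eqxx.
    rewrite !mxE ii /centered inner_pairsE outer_pairsE !eqxx /=; ring.
  apply: eq_bigr => j ji.
  rewrite !mxE /centered inner_pairsE outer_pairsE pair_prob_pair.
  rewrite [i == j]eq_sym [sigma j == _]eq_sym (negPf ji) /=.
  by case: (sigma i == sigma j) => /=; ring.
have -> : \sum_i v i * (\sum_j (if sigma j == sigma i then p else q) * v j) = 0.
  rewrite big1 // => i _.
  by rewrite (sum_cluster_fun0 (fun b => if b == sigma i then p else q) v0) mulr0.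
rewrite addr0 gerDl oppr_le0 mulr_ge0 // sumr_ge0 // => i _; exact: sqr_ge0.
Qed.

End BlockModel.

(** * Degree deviations and the total failure probability *)

Section RecoveryBound.
Variables (R : realType) (n k m : nat) (sigma : 'I_n -> 'I_k).
Hypothesis eqc : equal_clusters m sigma.
Hypotheses (nE : n = (k * m)%N) (m_gt0 : (0 < m)%N) (k_gt1 : (1 < k)%N).
Variables p q alpha beta L : R.
Hypotheses (p01 : 0 <= p <= 1) (q01 : 0 <= q <= 1).
Hypotheses (pE : p * m%:R = alpha * L) (qE : q * m%:R = beta * L).
Hypotheses (L_gt0 : 0 < L) (beta_gt0 : 0 < beta).
Implicit Type G : {set {set 'I_n}}.

Local Notation pr := (pair_prob sigma p q).
Local Notation E := (bits_E pr).

Let pr01 := pair_prob01 sigma p01 q01.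

Lemma deg_to_adjmx G b i :
  deg_to sigma (adjmx R G) b i = \sum_(j | sigma j == b) ([set i; j] \in G)%:R.
Proof. by apply: eq_bigr => j _; rewrite mxE. Qed.

Lemma pair_injective (i : 'I_n) : injective (fun j => [set i; j]).
Proof.
move=> j j' /setP jj; have := jj j; have := jj j'; rewrite !inE !eqxx !orbT.
by move=> /orP[/eqP->|/eqP->] // /esym/orP[/eqP->|/eqP->].
Qed.

Lemma sum_pair_prob_out b i : b != sigma i -> \sum_(j | sigma j == b) pr [set i; j] = beta * L.
Proof.
move=> bi; rewrite (eq_bigr (fun=> q)) => [|j /eqP jb].
  by rewrite (sum_cluster_const eqc) mulrC.
rewrite pair_prob_pair jb [_ == b]eq_sym (negPf bi).
by case: eqP => // ij; rewrite -jb ij eqxx in bi.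
Qed.

Lemma sum_pair_prob_in i : \sum_(j | sigma j == sigma i) pr [set i; j] = alpha * L - p.
Proof.
rewrite -pE [p * _]mulrC -(sum_cluster_const eqc _ (sigma i)).
rewrite (bigD1 i) //= [X in _ = X - _](bigD1 i) //= addrAC subrr add0r.
rewrite pair_prob_pair eqxx add0r; apply: eq_bigr => j /andP[/eqP ji ij].
by rewrite pair_prob_pair ji eqxx eq_sym (negPf ij).
Qed.

(** The edges from [i] to the two clusters are distinct, so one product computation suffices. The
    final 1 absorbs the absent self-pair, which costs at most [p]. *)
Lemma degree_gap_mgf (theta tau : R) i b : 0 <= theta -> b != sigma i ->
  E (fun G => expR (theta * (tau * L - deg_to sigma (adjmx R G) (sigma i) i
                             + deg_to sigma (adjmx R G) b i))) <=
  expR ((alpha * (expR (- theta) - 1) + beta * (expR theta - 1) + theta * tau) * L + 1).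
Proof.
move=> th bi; pose c j := if sigma j == sigma i then - theta else theta.
pose P := [pred j | (sigma j == sigma i) || (sigma j == b)].
have splitP (f : 'I_n -> R) : \sum_(j | P j) f j =
    \sum_(j | sigma j == sigma i) f j + \sum_(j | sigma j == b) f j.
  rewrite (bigID (fun j => sigma j == sigma i)) /=; congr (_ + _); apply: eq_bigl => j.
    by case: eqP; rewrite ?andbF.
  by case: eqP => [->|_]; rewrite ?andbF ?andbT ?orbF //= eq_sym (negPf bi).
have eqE G : expR (theta * (tau * L - deg_to sigma (adjmx R G) (sigma i) i
                             + deg_to sigma (adjmx R G) b i)) =
   expR (theta * tau * L) * expR (\sum_(j | P j) c j * ([set i; j] \in G)%:R).
  rewrite -expRD splitP !deg_to_adjmx; congr expR.
  have -> : \sum_(j | sigma j == sigma i) c j * ([set i; j] \in G)%:R =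
     - theta * \sum_(j | sigma j == sigma i) ([set i; j] \in G)%:R.
    by rewrite big_distrr; apply: eq_bigr => j ji; rewrite /c ji.
  have -> : \sum_(j | sigma j == b) c j * ([set i; j] \in G)%:R =
     theta * \sum_(j | sigma j == b) ([set i; j] \in G)%:R.
    by rewrite big_distrr; apply: eq_bigr => j /eqP jb; rewrite /c jb (negPf bi).
  ring.
rewrite (eq_bits_E _ eqE) bits_EZ.
have inj : {in P &, injective (fun j => [set i; j])} by move=> x y _ _; exact: pair_injective.
apply: le_trans (ler_wpM2l (expR_ge0 _) (bits_mgf_inj c pr01 inj)) _.
rewrite -expRD ler_expR splitP.
have -> : \sum_(j | sigma j == sigma i) pr [set i; j] * (expR (c j) - 1) =
    (alpha * L - p) * (expR (- theta) - 1).
  by rewrite -(sum_pair_prob_in i) big_distrl; apply: eq_bigr => j ji; rewrite /c ji.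
have -> : \sum_(j | sigma j == b) pr [set i; j] * (expR (c j) - 1) = beta * L * (expR theta - 1).
  by rewrite -(sum_pair_prob_out bi) big_distrl; apply: eq_bigr => j /eqP jb; rewrite /c jb (negPf bi).
have e0 := expR_ge0 (- theta); have e1 : expR (- theta) <= 1 by rewrite expR_le1 oppr_le0.
have /andP[p0 p1] := p01; nra.
Qed.

Variables (t eps : R).
Hypotheses (t01 : 0 < t <= 1/2) (eps_gt0 : 0 < eps) (t_eps : 8 * beta * t <= eps).

(** Smallness of [t] makes the quadratic term at most [t * eps / 4]. The resulting power of [m] is
    in general too weak for a union bound over vertices; it serves to control an average over a
    cluster. *)
Lemma degree_excess_mgf i b : b != sigma i ->
  E (fun G => expR (t * (deg_to sigma (adjmx R G) b i - (beta + eps / 2) * L))) <=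
  expR (- (t * eps / 4 * L)).
Proof.
move=> bi; have /andP[t0 t1] := t01.
have eqE G : expR (t * (deg_to sigma (adjmx R G) b i - (beta + eps / 2) * L)) =
   expR (- (t * (beta + eps / 2) * L)) *
   expR (\sum_(j | sigma j == b) t * ([set i; j] \in G)%:R).
  by rewrite -expRD -big_distrr -deg_to_adjmx; congr expR => /=; ring.
rewrite (eq_bits_E _ eqE) bits_EZ.
have inj : {in (fun j => sigma j == b) &, injective (fun j => [set i; j])}.
  by move=> x y _ _; exact: pair_injective.
apply: le_trans (ler_wpM2l (expR_ge0 _) (bits_mgf_inj (fun=> t) pr01 inj)) _.
rewrite -expRD ler_expR -big_distrl /= sum_pair_prob_out //.
have : expR t <= 1 + t + 2 * t ^+ 2 by apply: expR_le_quadratic; lra.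
move=> h; have : beta * L * (expR t - 1) <= beta * L * (t + 2 * t ^+ 2).
  by apply: ler_wpM2l; [rewrite mulr_ge0 // ltW|lra].
have : 8 * beta * t * (t * L) <= eps * (t * L).
  by apply: ler_wpM2r => //; rewrite mulr_ge0 // ltW.
rewrite expr2; nra.
Qed.

(** A pair of clusters spans [m ^ 2] independent edges, so the true exponent carries a factor [m];
    the weaker bound is kept to match that of [degree_excess_mgf]. *)
Lemma cross_deg_deficit_mgf a b : a != b ->
  E (fun G => expR (- t * (cross_deg sigma (adjmx R G) a b - (beta - eps) * L * m%:R))) <=
  expR (- (t * eps / 4 * L)).
Proof.
move=> ab; have /andP[t0 t1] := t01.
pose P := [pred x : 'I_n * 'I_n | (sigma x.1 == a) && (sigma x.2 == b)].
have cutE G : cross_deg sigma (adjmx R G) a b = \sum_(x | P x) ([set x.1; x.2] \in G)%:R.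
  rewrite /cross_deg (eq_bigr _ (fun i _ => deg_to_adjmx G b i)).
  by rewrite pair_big.
have eqE G : expR (- t * (cross_deg sigma (adjmx R G) a b - (beta - eps) * L * m%:R)) =
   expR (t * ((beta - eps) * L * m%:R)) *
   expR (\sum_(x | P x) (- t) * ([set x.1; x.2] \in G)%:R).
  by rewrite -expRD -big_distrr -cutE; congr expR => /=; ring.
rewrite (eq_bits_E _ eqE) bits_EZ.
have inj : {in P &, injective (fun x => [set x.1; x.2])}.
  move=> [i j] [i' j']; rewrite !inE /= => /andP[/eqP ia /eqP jb] /andP[/eqP ia' /eqP jb'] /setP h.
  have := h i; have := h j; rewrite !inE !eqxx orbT /=.
  move=> /esym/orP[/eqP jj|/eqP ->]; first by rewrite -jb jj ia' eqxx in ab.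
  by move=> /esym/orP[/eqP ->//|/eqP ij]; rewrite -ia ij jb' eqxx in ab.
apply: le_trans (ler_wpM2l (expR_ge0 _) (bits_mgf_inj (fun=> - t) pr01 inj)) _.
rewrite -expRD ler_expR -big_distrl /=.
have -> : \sum_(x | P x) pr [set x.1; x.2] = m%:R * (beta * L).
  rewrite -(pair_big (fun i => sigma i == a) (fun j => sigma j == b) (fun i j => pr [set i; j])) /=.
  rewrite -(sum_cluster_const eqc _ a); apply: eq_bigr => i /eqP ia.
  by apply: sum_pair_prob_out; rewrite ia eq_sym.
have h : expR (- t) <= 1 + - t + 2 * (- t) ^+ 2 by apply: expR_le_quadratic; lra.
have m1 : 1 <= m%:R :> R by rewrite ler1n.
have mL : L <= m%:R * L by rewrite ler_peMl // ltW.
have : m%:R * (beta * L) * (expR (- t) - 1) <= m%:R * (beta * L) * (- t + 2 * t ^+ 2).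
  by apply: ler_wpM2l; [rewrite !mulr_ge0 // ltW|rewrite sqrrN in h; lra].
have : 8 * beta * t * (t * (m%:R * L)) <= eps * (t * (m%:R * L)).
  by apply: ler_wpM2r => //; rewrite !mulr_ge0 // ltW.
have : t * eps * L <= t * eps * (m%:R * L).
  by apply: ler_wpM2l => //; rewrite mulr_ge0 // ltW.
have : 0 <= t * eps * (m%:R * L) by rewrite !mulr_ge0 // ltW.
set X := m%:R * L.
have -> : t * ((beta - eps) * L * m%:R) = t * (beta - eps) * X by rewrite /X; ring.
have -> : m%:R * (beta * L) = beta * X by rewrite /X; ring.
by rewrite expr2; lra.
Qed.

Variables (theta tau d1 d2 : R).
Hypothesis theta_gt0 : 0 < theta.
Hypotheses (d1_ge1 : 1 <= d1) (d2_ge1 : 1 <= d2).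
Hypotheses (d1_ge : alpha * L <= d1) (d2_ge : k%:R * beta * L <= d2).
Hypothesis norm_small :
  spectral_const R * (Num.sqrt d1 + Num.sqrt d2) + eps * L <= (tau - 2 * eps) * L.

Lemma sbm_recovery_ge :
  1 - (n%:R * k%:R * expR ((alpha * (expR (- theta) - 1) + beta * (expR theta - 1)
                            + theta * tau) * L + 1)
       + k%:R ^+ 2 * expR (- (t * eps / 4 * L))
       + k%:R ^+ 2 * expR (- (t * eps / 4 * L)) / (t * (eps / 2) * L)
       + n%:R * expR (- (2 * d1)) + n%:R * expR (- (2 * d2)))
  <= sbm_prob p q sigma (sdp_recovers R sigma).
Proof.
have /andP[t0 t1] := t01; have m0 : 0 < (m%:R : R) by rewrite ltr0n.
have [F1 [F1_ge0 EF1 F1_norm]] : exists F : {set {set 'I_n}} -> R,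
   [/\ forall G, 0 <= F G, E F <= n%:R * expR (- (2 * d1)) &
    forall G, F G < 1 -> forall x,
      bilin (edge_mx (centered pr (inner_pairs sigma)) G) x x <=
      spectral_const R * Num.sqrt d1 * \sum_i x i ^+ 2].
  apply: (centered_spectral_bound (tau := sigma) (w := m) p01) => //.
  - by rewrite mulrC pE.
  - move=> e; rewrite inE => /andP[ev ea]; rewrite /pair_prob ev /edge_prob.
    by rewrite ea.
  - by move=> x y xy; rewrite inner_pairsE (negPf xy) andbF.
  - by move=> x; rewrite -(eqc (sigma x)); apply: subset_leq_card; apply/fintype.subsetP => y; rewrite !inE.
have [F2 [F2_ge0 EF2 F2_norm]] : exists F : {set {set 'I_n}} -> R,
   [/\ forall G, 0 <= F G, E F <= n%:R * expR (- (2 * d2)) &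
    forall G, F G < 1 -> forall x,
      bilin (edge_mx (centered pr (outer_pairs sigma)) G) x x <=
      spectral_const R * Num.sqrt d2 * \sum_i x i ^+ 2].
  (* Outer edges reach every cluster, so there is one cell of size [n]; their density is only [q],
     and [n * q = k * beta * L]. *)
  apply: (centered_spectral_bound (tau := fun=> tt) (w := n) q01) => //.
  - by apply: le_trans d2_ge; rewrite nE natrM -mulrA [m%:R * q]mulrC qE mulrA.
  - move=> e; rewrite finset.in_setD => /andP[ei ev]; rewrite /pair_prob ev /edge_prob.
    by move: ei; rewrite /inner_pairs inE ev /= => /negPf ->.
  - by move=> x; apply: leq_trans (max_card _) _; rewrite card_ord.
pose T1 i b G := expR (theta * (tau * L - deg_to sigma (adjmx R G) (sigma i) i
                             + deg_to sigma (adjmx R G) b i)).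
pose T2 a b G := expR (- t * (cross_deg sigma (adjmx R G) a b - (beta - eps) * L * m%:R)).
pose X i b G := expR (t * (deg_to sigma (adjmx R G) b i - (beta + eps / 2) * L)).
(* Normalized so that [T3 a G < 1] bounds the cluster average of the sums of [X] by
   [t * (eps / 2) * L]. *)
pose c3 := (t * (eps / 2) * L * m%:R)^-1.
pose T3 a G := c3 * \sum_(i | sigma i == a) \sum_(b | b != sigma i) X i b G.
(* Recovery holds wherever F < 1, so Markov's inequality for F replaces all the
   union bounds. *)
pose F G := (\sum_i \sum_(b | b != sigma i) T1 i b G) + (\sum_a \sum_(b | a != b) T2 a b G)
   + (\sum_a T3 a G) + F1 G + F2 G.
have c3_gt0 : 0 < c3 by rewrite invr_gt0 !mulr_gt0 // divr_gt0.
have S1 G : 0 <= \sum_i \sum_(b | b != sigma i) T1 i b G.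
  by apply: sumr_ge0 => i _; apply: sumr_ge0 => b _; exact: expR_ge0.
have S2 G : 0 <= \sum_a \sum_(b | a != b) T2 a b G.
  by apply: sumr_ge0 => i _; apply: sumr_ge0 => b _; exact: expR_ge0.
have T3_ge0 a G : 0 <= T3 a G.
  apply: mulr_ge0; first exact: ltW.
  by apply: sumr_ge0 => i _; apply: sumr_ge0 => b _; exact: expR_ge0.
have S3 G : 0 <= \sum_a T3 a G by exact: sumr_ge0.
have le_one (I : finType) (P : pred I) (f : I -> R) i : P i -> (forall i, 0 <= f i) ->
    \sum_(j | P j) f j < 1 -> f i < 1.
  move=> Pi f0; apply: le_lt_trans; rewrite (bigD1 i) //= lerDl.
  by apply: sumr_ge0.
have EF : E F <= n%:R * k%:R * expR ((alpha * (expR (- theta) - 1) + beta * (expR theta - 1)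
                            + theta * tau) * L + 1)
       + k%:R ^+ 2 * expR (- (t * eps / 4 * L))
       + k%:R ^+ 2 * expR (- (t * eps / 4 * L)) / (t * (eps / 2) * L)
       + n%:R * expR (- (2 * d1)) + n%:R * expR (- (2 * d2)).
  have cnt (I : finType) (P : pred I) (f : I -> R) c : 0 <= c -> (forall i, P i -> f i <= c) ->
      \sum_(j | P j) f j <= #|I|%:R * c.
    move=> c0 fc; apply: le_trans (_ : \sum_(j : I) c <= _).
      rewrite big_mkcond; apply: ler_sum => i _; case: ifP => // Pi; exact: fc.
    by rewrite sumr_const mulr_natl.
  rewrite !bits_ED; apply: lerD EF2; apply: lerD EF1; apply: lerD; first apply: lerD.
  - rewrite bits_E_sum -mulrA -[n in leRHS]card_ord; apply: (cnt) => [|i _].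
      by rewrite mulr_ge0 // expR_ge0.
    rewrite bits_E_sum -[k in leRHS]card_ord; apply: (cnt) => [|b bi]; first exact: expR_ge0.
    exact: degree_gap_mgf (ltW theta_gt0) _.
  - rewrite bits_E_sum expr2 -mulrA -[k in leRHS]card_ord; apply: (cnt) => [|a _].
      by rewrite mulr_ge0 // expR_ge0.
    rewrite bits_E_sum; apply: (cnt) => [|b ab]; first exact: expR_ge0.
    exact: cross_deg_deficit_mgf.
  - rewrite bits_E_sum expr2 -2!mulrA -[k in leRHS]card_ord; apply: (cnt) => [|a _].
      by rewrite mulr_ge0 // divr_ge0 ?expR_ge0 // !mulr_ge0 // ltW // divr_gt0.
    rewrite bits_EZ bits_E_sum.
    apply: le_trans (_ : c3 * (m%:R * (#|'I_k|%:R * expR (- (t * eps / 4 * L)))) <= _).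
      apply: ler_wpM2l; first exact: ltW.
      rewrite -(sum_cluster_const eqc _ a); apply: ler_sum => i _.
      rewrite bits_E_sum; apply: (cnt) => [|b bi]; first exact: expR_ge0.
      exact: degree_excess_mgf.
    rewrite le_eqVlt; apply/orP; left; apply/eqP; rewrite /c3; field.
    by rewrite !gt_eqF.
apply: le_trans (_ : 1 - E F <= _); first by rewrite lerD2l lerN2.
apply: (sbm_prob_ge sigma p01 q01) => [G|G sG FG].
  by rewrite /F !addr_ge0.
have f1 : \sum_i \sum_(b | b != sigma i) T1 i b G < 1.
  by have := F1_ge0 G; have := F2_ge0 G; have := S2 G; have := S3 G; move: FG; rewrite /F; lra.
have f2 : \sum_a \sum_(b | a != b) T2 a b G < 1.
  by have := F1_ge0 G; have := F2_ge0 G; have := S1 G; have := S3 G; move: FG; rewrite /F; lra.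
have f3 : \sum_a T3 a G < 1.
  by have := F1_ge0 G; have := F2_ge0 G; have := S1 G; have := S2 G; move: FG; rewrite /F; lra.
have f4 : F1 G < 1.
  by have := F2_ge0 G; have := S1 G; have := S2 G; have := S3 G; move: FG; rewrite /F; lra.
have f5 : F2 G < 1.
  by have := F1_ge0 G; have := S1 G; have := S2 G; have := S3 G; move: FG; rewrite /F; lra.
have {}f1 i b : b != sigma i ->
    deg_to sigma (adjmx R G) b i <= deg_to sigma (adjmx R G) (sigma i) i - tau * L.
  move=> bi.
  have : \sum_(b | b != sigma i) T1 i b G < 1.
    apply: (le_one _ predT (fun i => \sum_(b | b != sigma i) T1 i b G)) f1 => // j.
    by apply: sumr_ge0 => *; exact: expR_ge0.
  move/(le_one _ _ (fun b => T1 i b G) b bi (fun=> expR_ge0 _)).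
  by rewrite /T1 expR_lt1 pmulr_rlt0 //; lra.
have {}f2 a b : a != b -> (beta - eps) * L * m%:R <= cross_deg sigma (adjmx R G) a b.
  move=> ab.
  have : \sum_(b | a != b) T2 a b G < 1.
    apply: (le_one _ predT (fun a => \sum_(b | a != b) T2 a b G)) f2 => // j.
    by apply: sumr_ge0 => *; exact: expR_ge0.
  move/(le_one _ _ (fun b => T2 a b G) b ab (fun=> expR_ge0 _)).
  by rewrite /T2 expR_lt1 mulNr oppr_lt0 pmulr_rgt0 //; lra.
have {}f3 a : \sum_(i | sigma i == a) \sum_(b | b != sigma i) X i b G <= t * (eps / 2) * L * m%:R.
  have : T3 a G < 1 by apply: (le_one _ predT (fun a => T3 a G)) f3.
  have c0 : 0 < t * (eps / 2) * L * m%:R by rewrite !mulr_gt0 // divr_gt0.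
  by rewrite /T3 /c3 ltr_pdivrMl // mulr1 => /ltW.
(* The default 0 is harmless: degrees are nonnegative and, as [k > 1], some foreign cluster
   exists. *)
pose M i := \big[Num.max/0]_(b | b != sigma i) deg_to sigma (adjmx R G) b i.
have deg0 b i : 0 <= deg_to sigma (adjmx R G) b i.
  by rewrite deg_to_adjmx sumr_ge0.
have other i : exists b, b != sigma i.
  have : (0 < #|~: [set sigma i]|)%N by rewrite cardsC1 card_ord; case: (k) k_gt1 => [|[]].
  by case/card_gt0P => b; rewrite !inE => bi; exists b.
apply: (@certificate_recovers R n k m sigma nE eqc (ltnW k_gt1) m_gt0 (adjmx R G) M
  ((beta - eps) * L / 2) (spectral_const R * (Num.sqrt d1 + Num.sqrt d2)) (eps * L)).
- by apply/matrixP => i j; rewrite !mxE finset.setUC.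
- exact: mulr_gt0.
- by move=> i b bi; apply: (le_bigmax_cond _ (fun b => deg_to sigma (adjmx R G) b i)).
- by move=> a b ab; rewrite mulrCA divff // mulr1 f2.
- move=> i.
  have Mi : M i <= deg_to sigma (adjmx R G) (sigma i) i - tau * L.
    have [b bi] := other i.
    apply: bigmax_le => [|b' b'i]; last exact: f1.
    by apply: le_trans (f1 i b bi).
  have Mavg : cavg m sigma M (sigma i) <= (beta + eps) * L.
    rewrite /cavg ler_pdivrMr //.
    (* As [x <= expR (t * x) / t], the maximum defining [M j] exceeds [(beta + eps / 2) * L] by at
       most [t^-1] times the sum of all [X j b]. *)
    apply: le_trans (_ : \sum_(j | sigma j == sigma i)
      ((beta + eps / 2) * L + t^-1 * \sum_(b | b != sigma j) X j b G) <= _).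
      apply: ler_sum => j _; apply: bigmax_le => [|b bj].
        apply: addr_ge0; first by rewrite mulr_ge0 ?ltW // addr_gt0 // divr_gt0.
        apply: mulr_ge0; first by rewrite invr_ge0 ltW.
        by apply: sumr_ge0 => *; exact: expR_ge0.
      rewrite -lerBlDl ler_pdivlMl //.
      apply: le_trans (_ : X j b G <= _).
        by rewrite /X; have := expR_ge1Dx (t * (deg_to sigma (adjmx R G) b j - (beta + eps / 2) * L)); lra.
      by rewrite (bigD1 b) //= lerDl sumr_ge0 // => *; exact: expR_ge0.
    rewrite big_split /= (sum_cluster_const eqc) -[X in _ + X]big_distrr /=.
    have h : t^-1 * \sum_(j | sigma j == sigma i) \sum_(b | b != sigma j) X j b G <= eps / 2 * L * m%:R.
      by rewrite ler_pdivrMl //; apply: le_trans (f3 _) _; rewrite !mulrA.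
    by move: h; have -> : (beta + eps) * L * m%:R = m%:R * ((beta + eps / 2) * L) + eps / 2 * L * m%:R
      by [field]; lra.
  (* Here [2 * h - cavg M] is at least [- 2 * eps * L], so the degree gap [tau * L] keeps what
     [norm_small] asks for. *)
  move: norm_small Mi Mavg; have -> : 2 * ((beta - eps) * L / 2) = (beta - eps) * L by field.
  by lra.
- move=> v v0; apply: le_trans (adjmx_quadratic_le q p01 sG v0) _.
  by have := F1_norm G f4 v; have := F2_norm G f5 v; rewrite /bilin; lra.
Qed.

End RecoveryBound.
(** * Asymptotics *)

Section Asymptotics.
Variable R : realType.
Local Notation C := (spectral_const R).

Lemma sqrt_add_le (a b : R) : 0 <= a -> 0 <= b -> Num.sqrt (a + b) <= Num.sqrt a + Num.sqrt b.
Proof.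
move=> a0 b0; rewrite -ler_sqr ?nnegrE ?addr_ge0 ?sqrtr_ge0 // sqrrD !sqr_sqrtr ?addr_ge0 //.
have := mulr_ge0 (sqrtr_ge0 a) (sqrtr_ge0 b); lra.
Qed.

Lemma ln_sqrt_ratio_gt0 (alpha beta : R) : 0 < beta -> beta < alpha ->
  0 < ln (Num.sqrt (alpha / beta)).
Proof.
move=> b0 ba; have a0 : 0 < alpha by apply: lt_trans ba.
by rewrite ln_gt0 // -sqrtr1 ltr_sqrt ?divr_gt0 // ltr_pdivlMr // mul1r.
Qed.

(** This [theta] minimizes [alpha * expR (- theta) + beta * expR theta], the minimum being
    [2 * sqrt (alpha * beta)]. *)
Lemma chernoff_exponent (alpha beta : R) : 0 < alpha -> 0 < beta ->
  let theta := ln (Num.sqrt (alpha / beta)) in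
  alpha * (expR (- theta) - 1) + beta * (expR theta - 1) = - (Num.sqrt alpha - Num.sqrt beta) ^+ 2.
Proof.
move=> a0 b0 /=; have sa : 0 < Num.sqrt alpha by rewrite sqrtr_gt0.
have sb : 0 < Num.sqrt beta by rewrite sqrtr_gt0.
rewrite expRN lnK; last by rewrite posrE sqrtr_gt0 divr_gt0.
rewrite sqrtrM ?ltW // sqrtrV ?ltW //.
have ea : alpha = Num.sqrt alpha ^+ 2 by rewrite sqr_sqrtr // ltW.
have eb : beta = Num.sqrt beta ^+ 2 by rewrite sqr_sqrtr // ltW.
rewrite {1}ea {2}eb; field; by rewrite !gt_eqF.
Qed.

Section OneInstance.
Variables (alpha beta gamma eta eps t omega : R) (k m : nat).
Local Notation L := (ln (m%:R : R)).
Local Notation n := (k * m)%N.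
Local Notation theta := (ln (Num.sqrt (alpha / beta))).
Local Notation tau := (C * Num.sqrt (beta * gamma) + 6 * eps).
Hypotheses (beta_gt0 : 0 < beta) (beta_lt : beta < alpha) (gamma_ge0 : 0 <= gamma).
Hypotheses (eta_gt0 : 0 < eta) (eps_gt0 : 0 < eps) (omega_gt0 : 0 < omega).
Hypotheses (eta_small : C * Num.sqrt (beta * eta) <= eps).
Hypotheses (t01 : 0 < t <= 1/2) (t_eps : 8 * beta * t <= eps).
Hypothesis exponent_gt : 1 + omega <= (Num.sqrt alpha - Num.sqrt beta) ^+ 2 - theta * tau.
Hypotheses (omega1 : omega <= 1) (omega_t : omega <= t * eps / 4).
Hypotheses (k_gt1 : (1 < k)%N) (m_gt0 : (0 < m)%N).
Hypotheses (L1 : 1 <= L) (Lm : alpha * L <= m%:R) (ln_n : ln (n%:R : R) <= 2 * L).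
Hypothesis k_le : k%:R <= (gamma + eta) * L.
Hypothesis sqrt_le : C * Num.sqrt (alpha * L + 2 * L + 1) <= eps * L.
Hypothesis L_large : (expR 1 + 3 + (t * (eps / 2))^-1) * (gamma + eta) ^+ 2 * L ^+ 2 <= expR (omega / 2 * L).

(** Each failure term is a constant times [k ^+ 2 * expR (- (omega * L))]. The constants and
    [k ^+ 2] are absorbed by half of the exponent, and [n <= m ^ 2] turns the remaining half into
    [n ^ (- omega / 4)]. *)
Lemma sbm_recovery_instance (sigma : 'I_n -> 'I_k) : equal_clusters m sigma ->
  1 - n%:R `^ (- (omega / 4)) <=
  sbm_prob (alpha * L / m%:R) (beta * L / m%:R) sigma (sdp_recovers R sigma).
Proof.
move=> eqc; have m0 : 0 < (m%:R : R) by rewrite ltr0n.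
have k0 : 0 < (k%:R : R) by rewrite ltr0n ltnW.
have n0 : 0 < (n%:R : R) by rewrite ltr0n muln_gt0 (ltnW k_gt1).
have L0 : 0 < L by apply: lt_le_trans L1.
have alpha_gt0 : 0 < alpha by apply: lt_trans beta_lt.
have C0 := spectral_const_gt0 R.
have p01 : 0 <= alpha * L / m%:R <= 1.
  apply/andP; split; last by rewrite ler_pdivrMr // mul1r.
  by apply: divr_ge0 => //; apply: mulr_ge0; exact: ltW.
have q01 : 0 <= beta * L / m%:R <= 1.
  apply/andP; split; last first.
    rewrite ler_pdivrMr // mul1r; apply: le_trans Lm.
    by apply: ler_wpM2r; exact: ltW.
  by apply: divr_ge0 => //; apply: mulr_ge0; exact: ltW.
have theta0 : 0 < theta.
  exact: ln_sqrt_ratio_gt0.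
(* The extra [2 * L] makes [expR (- (2 * d))] beat [n <= m ^ 2]. *)
pose d1 := alpha * L + 2 * L + 1; pose d2 := k%:R * beta * L + 2 * L + 1.
have aL0 : 0 <= alpha * L by rewrite mulr_ge0 // ltW.
have kb0 : 0 <= k%:R * beta * L by rewrite !mulr_ge0 // ltW.
(* The six [eps] of [tau]: one for [d1], one for [eta], one for the [2 * L + 1] in [d2], one for the
   slack [del], and two subtracted on the right. *)
have norm_small : C * (Num.sqrt d1 + Num.sqrt d2) + eps * L <= (tau - 2 * eps) * L.
  have s1 : C * Num.sqrt (2 * L + 1) <= eps * L.
    apply: le_trans sqrt_le; apply: ler_wpM2l; first exact: ltW.
    by apply: ler_wsqrtr; lra.
  have s2 : Num.sqrt d2 <= Num.sqrt (k%:R * beta * L) + Num.sqrt (2 * L + 1).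
    by rewrite /d2 -addrA; apply: sqrt_add_le => //; lra.
  have s3 : Num.sqrt (k%:R * beta * L) <= (Num.sqrt (beta * gamma) + Num.sqrt (beta * eta)) * L.
    apply: le_trans (_ : Num.sqrt ((beta * gamma + beta * eta) * L ^+ 2) <= _).
      have bL0 : 0 <= beta * L by apply: mulr_ge0; exact: ltW.
      by apply: ler_wsqrtr; have := ler_wpM2l bL0 k_le; rewrite expr2; lra.
    have bg0 : 0 <= beta * gamma by rewrite mulr_ge0 // ltW.
    have be0 : 0 <= beta * eta by rewrite mulr_ge0 // ltW.
    rewrite sqrtrM ?addr_ge0 // sqrtr_sqr (ger0_norm (ltW L0)).
    by apply: ler_wpM2r; [exact: ltW|exact: sqrt_add_le].
  have := ler_wpM2l (ltW C0) s2; have := ler_wpM2l (ltW C0) s3.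
  have := ler_wpM2r (ltW L0) eta_small; have := sqrt_le; rewrite -/d1.
  lra.
have d1_1 : 1 <= d1 by rewrite /d1; lra.
have d2_1 : 1 <= d2 by rewrite /d2; lra.
have d1_ge : alpha * L <= d1 by rewrite /d1; lra.
have d2_ge : k%:R * beta * L <= d2 by rewrite /d2; lra.
have pE : alpha * L / m%:R * m%:R = alpha * L by rewrite divfK // gt_eqF.
have qE : beta * L / m%:R * m%:R = beta * L by rewrite divfK // gt_eqF.
apply: le_trans (sbm_recovery_ge eqc erefl m_gt0 k_gt1 p01 q01 pE qE L0 beta_gt0
  t01 eps_gt0 t_eps theta0 d1_1 d2_1 d1_ge d2_ge norm_small).
rewrite lerD2l lerN2.
have mL : m%:R = expR L by rewrite lnK.
have kk : 1 <= k%:R ^+ 2 :> R by rewrite exprn_ege1 // ler1n ltnW.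
set W := expR (- (omega * L)).
have W0 : 0 < W by exact: expR_gt0.
have /andP[t0 _] := t01.
have te0 : 0 < t * (eps / 2) by rewrite mulr_gt0 // divr_gt0.
have b1 : n%:R * k%:R * expR ((alpha * (expR (- theta) - 1) + beta * (expR theta - 1)
                            + theta * tau) * L + 1) <= expR 1 * (k%:R ^+ 2 * W).
  rewrite chernoff_exponent // natrM.
  have -> : k%:R * m%:R * k%:R = k%:R ^+ 2 * expR L by rewrite -mL; ring.
  rewrite [leRHS]mulrCA -[leLHS]mulrA; apply: ler_wpM2l; first exact: sqr_ge0.
  rewrite -!expRD ler_expR.
  have := ler_wpM2r (ltW L0) exponent_gt; lra.
have b2 : expR (- (t * eps / 4 * L)) <= W by rewrite ler_expR lerN2 ler_wpM2r // ltW.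
have b3 : k%:R ^+ 2 * expR (- (t * eps / 4 * L)) <= k%:R ^+ 2 * W.
  by apply: ler_wpM2l b2; exact: sqr_ge0.
have b4 : k%:R ^+ 2 * expR (- (t * eps / 4 * L)) / (t * (eps / 2) * L)
    <= (t * (eps / 2))^-1 * (k%:R ^+ 2 * W).
  rewrite [leRHS]mulrC; apply: ler_pM b3 _; first by rewrite mulr_ge0 ?sqr_ge0 // expR_ge0.
    by rewrite invr_ge0 mulr_ge0 // ltW.
  by rewrite lef_pV2 ?posrE ?mulr_gt0 // ler_peMr // ltW.
have b5 d : 2 * L + 1 <= d -> n%:R * expR (- (2 * d)) <= k%:R ^+ 2 * W.
  move=> dL; apply: le_trans (_ : 1 * W <= _); last by apply: ler_wpM2r; [exact: ltW|].
  have -> : n%:R = expR (ln n%:R) :> R by rewrite lnK.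
  rewrite mul1r -expRD ler_expR.
  have := ler_wpM2r (ltW L0) omega1; have := ln_n; move: (ln n%:R) => x; lra.
have b6 := b5 d1; have b7 := b5 d2.
have {}b6 : n%:R * expR (- (2 * d1)) <= k%:R ^+ 2 * W by apply: b6; rewrite /d1; lra.
have {}b7 : n%:R * expR (- (2 * d2)) <= k%:R ^+ 2 * W by apply: b7; rewrite /d2; lra.
apply: le_trans (_ : (expR 1 + 3 + (t * (eps / 2))^-1) * (k%:R ^+ 2 * W) <= _); first lra.
have kL : k%:R ^+ 2 <= (gamma + eta) ^+ 2 * L ^+ 2.
  rewrite -exprMn; apply: lerXn2r k_le; rewrite nnegrE ?ltW //.
  by rewrite mulr_gt0 // ltr_wpDl.
have K0 : 0 <= expR 1 + 3 + (t * (eps / 2))^-1.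
  by rewrite !addr_ge0 ?expR_ge0 // invr_ge0 ltW.
apply: le_trans (_ : expR (omega / 2 * L) * W <= _).
  rewrite mulrA; apply: ler_wpM2r; first exact: ltW.
  by apply: le_trans L_large; rewrite -mulrA; apply: ler_wpM2l.
rewrite /powR gt_eqF // -expRD ler_expR.
have := ler_wpM2l (ltW omega_gt0) ln_n; lra.
Qed.

End OneInstance.

(** * Limits along the sequence of instances *)

Section Sequences.
Local Open Scope classical_set_scope.
Local Open Scope ring_scope.
Variables (alpha beta gamma : R) (k m : nat -> nat).
Hypotheses (beta_gt0 : 0 < beta) (beta_lt : beta < alpha) (gamma_ge0 : 0 <= gamma).
Hypotheses (k_ge2 : forall t, (2 <= k t)%N) (m_ge1 : forall t, (1 <= m t)%N).
Hypothesis n_oo : (fun t => (k t * m t)%N) @ \oo --> \oo.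
Hypothesis k_bigO : exists2 K : R, 0 < K & \forall t \near \oo, (k t)%:R <= K * ln (m t)%:R.
Hypothesis k_asymp : forall e : R, 0 < e ->
  \forall t \near \oo, (k t)%:R <= (gamma + e) * ln (k t * m t)%:R.

(** If [ln m] stayed below [B], then [k <= K * B] and [m <= expR B] would bound [k * m], which tends
    to infinity. *)
Lemma ln_m_large (A : R) : \forall t \near \oo, A <= ln (m t)%:R.
Proof.
have [K K0 kK] := k_bigO.
pose B := Num.max A 0; have B0 : 0 <= B by rewrite le_max lexx orbT.
have big : \forall t \near \oo, (Num.bound (K * B * expR B) <= k t * m t)%N.
  by move/cvgnyPge: n_oo; apply.
near=> t; rewrite leNgt; apply/negP => LA.
have kt : (k t)%:R <= K * ln (m t)%:R by near: t.
have bt : (Num.bound (K * B * expR B) <= k t * m t)%N by near: t.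
have m0 : 0 < ((m t)%:R : R) by rewrite ltr0n.
have LB : ln (m t)%:R <= B by rewrite le_max ltW.
have KB0 : 0 <= K * B * expR B by rewrite !mulr_ge0 ?expR_ge0 // ltW.
have : K * B * expR B < (k t * m t)%:R.
  by apply: lt_le_trans (archi_boundP KB0) _; rewrite ler_nat.
apply/negP; rewrite -leNgt natrM; apply: ler_pM => //.
  by apply: le_trans kt _; apply: ler_wpM2l => //; exact: ltW.
by rewrite -[leLHS]lnK ?posrE // ler_expR.
Unshelve. all: by end_near. Qed.

Lemma linear_le_expR (a b : R) : 0 < b ->
  \forall t \near \oo, a * ln (m t)%:R <= expR (b * ln (m t)%:R).
Proof.
move=> b0; near=> t.
have L1 : 0 <= ln (m t)%:R :> R by near: t; exact: ln_m_large.
have L2 : 2 * a / b ^+ 2 <= ln (m t)%:R by near: t; exact: ln_m_large.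
move: L1 L2; set L := ln _ => L1 L2.
have bL0 : 0 <= b * L by rewrite mulr_ge0 // ltW.
have := expR_ge1Dxn 1 bL0; rewrite /= => h.
have : 2 * a <= L * b ^+ 2 by rewrite -ler_pdivrMr // exprn_gt0.
move=> h2; have := ler_wpM2r L1 h2 => h3; move: h; rewrite exprMn => h.
have -> : a * L = 2 * a * L / 2 by field.
apply: le_trans h; apply: le_trans (_ : L * b ^+ 2 * L / 2 <= _); first lra.
have -> : L * b ^+ 2 * L / 2 = b ^+ 2 * L ^+ 2 / 2 by ring.
by rewrite lerDr.
Unshelve. all: by end_near. Qed.

Lemma quadratic_le_expR (a b : R) : 0 < b ->
  \forall t \near \oo, a * ln (m t)%:R ^+ 2 <= expR (b * ln (m t)%:R).
Proof.
move=> b0; near=> t.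
have L1 : 0 <= ln (m t)%:R :> R by near: t; exact: ln_m_large.
have L2 : 6 * a / b ^+ 3 <= ln (m t)%:R by near: t; exact: ln_m_large.
move: L1 L2; set L := ln _ => L1 L2.
have bL0 : 0 <= b * L by rewrite mulr_ge0 // ltW.
have := expR_ge1Dxn 2 bL0; rewrite /= => h.
have : 6 * a <= L * b ^+ 3 by rewrite -ler_pdivrMr // exprn_gt0.
move=> h2; have := ler_wpM2r (sqr_ge0 L) h2 => h3; move: h; rewrite exprMn => h.
apply: le_trans h; apply: le_trans (_ : L * b ^+ 3 * L ^+ 2 / 6 <= _); first lra.
have -> : L * b ^+ 3 * L ^+ 2 / 6 = b ^+ 3 * L ^+ 3 / 6 by ring.
by rewrite lerDr.
Unshelve. all: by end_near. Qed.

Lemma ln_n_le (e : R) : 0 < e ->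
  \forall t \near \oo, ln (k t * m t)%:R <= (1 + e) * ln (m t)%:R.
Proof.
move=> e0; have [K K0 kK] := k_bigO; near=> t.
have kt : (k t)%:R <= K * ln (m t)%:R by near: t.
have h : K * ln (m t)%:R <= expR (e * ln (m t)%:R) by near: t; exact: linear_le_expR.
have k0 : 0 < ((k t)%:R : R) by rewrite ltr0n; apply: leq_trans (k_ge2 t).
rewrite natrM lnM ?posrE ?ltr0n //; last by apply: leq_trans (k_ge2 t).
have : ln (k t)%:R <= e * ln (m t)%:R.
  by rewrite -[leRHS]expRK ler_ln ?posrE ?expR_gt0 //; apply: le_trans h.
lra.
Unshelve. all: by end_near. Qed.

Lemma k_le_ln_m (e : R) : 0 < e ->
  \forall t \near \oo, (k t)%:R <= (gamma + e) * ln (m t)%:R.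
Proof.
move=> e0; have g1 : 0 < gamma + e / 2 by rewrite ltr_wpDl // divr_gt0.
(* Chosen so that [(gamma + e / 2) * (1 + e') = gamma + e]. *)
pose e' := e / 2 / (gamma + e / 2); have e'0 : 0 < e' by rewrite divr_gt0 // divr_gt0.
near=> t.
have h1 : (k t)%:R <= (gamma + e / 2) * ln (k t * m t)%:R.
  by near: t; apply: k_asymp; rewrite divr_gt0.
have h2 : ln (k t * m t)%:R <= (1 + e') * ln (m t)%:R by near: t; exact: ln_n_le.
apply: le_trans h1 _; apply: le_trans (ler_wpM2l (ltW g1) h2) _.
rewrite mulrA le_eqVlt; apply/orP; left; apply/eqP; congr (_ * _).
by rewrite mulrDr mulr1 [_ * e']mulrC /e' divfK ?gt_eqF //; field.
Unshelve. all: by end_near. Qed.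

(** Both regimes are instances, [gamma = 0] standing for [k = o(log n)]. The exponent slack [s] is
    shared: half pays for the [6 * eps] in [tau], the other half bounds [omega]. *)
Lemma recovers_whp_of_gap :
  1 + C * Num.sqrt (beta * gamma) * (1 + ln (Num.sqrt (alpha / beta))) <
    (Num.sqrt alpha - Num.sqrt beta) ^+ 2 ->
  recovers_whp alpha beta k m.
Proof.
set theta := ln _ => gap.
have alpha_gt0 : 0 < alpha by apply: lt_trans beta_lt.
have theta0 : 0 < theta.
  exact: ln_sqrt_ratio_gt0.
have C0 := spectral_const_gt0 R.
pose s := (Num.sqrt alpha - Num.sqrt beta) ^+ 2 - 1 - C * Num.sqrt (beta * gamma) * theta.
have s0 : 0 < s.
  have : 0 <= C * Num.sqrt (beta * gamma) by rewrite mulr_ge0 ?sqrtr_ge0 // ltW.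
  by move: gap; rewrite /s; lra.
pose eps := s / (12 * theta); have eps0 : 0 < eps by rewrite divr_gt0 // mulr_gt0.
pose t := Num.min (1/2) (eps / (8 * beta)).
have t0 : 0 < t by rewrite lt_min !divr_gt0 // mulr_gt0.
have t_half : t <= 1/2 by rewrite ge_min lexx.
have t01 : 0 < t <= 1/2 by rewrite t0.
have t_eps : 8 * beta * t <= eps.
  by rewrite mulrC -ler_pdivlMr ?mulr_gt0 // ge_min lexx orbT.
pose eta := (eps / C) ^+ 2 / beta.
have eta0 : 0 < eta by rewrite divr_gt0 // exprn_gt0 // divr_gt0.
have eta_small : C * Num.sqrt (beta * eta) <= eps.
  rewrite /eta mulrC [beta * _]mulrC divfK ?gt_eqF // sqrtr_sqr ger0_norm ?divfK ?gt_eqF //.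
  by rewrite divr_ge0 // ltW.
pose omega := Num.min (Num.min (s / 2) 1) (t * eps / 4).
have omega0 : 0 < omega by rewrite !lt_min ltr01 !divr_gt0 // mulr_gt0.
have omega_s : omega <= s / 2 by rewrite !ge_min lexx.
have omega1 : omega <= 1 by rewrite !ge_min lexx orbT.
have omega_t : omega <= t * eps / 4 by rewrite !ge_min lexx orbT.
have exponent : 1 + omega <= (Num.sqrt alpha - Num.sqrt beta) ^+ 2
    - theta * (C * Num.sqrt (beta * gamma) + 6 * eps).
  have : theta * (6 * eps) = s / 2 by rewrite /eps; field; rewrite gt_eqF.
  by move: omega_s; rewrite /s; lra.
exists (omega / 4); first by rewrite divr_gt0.
have omega20 : 0 < omega / 2 by rewrite divr_gt0.
near=> j.
have L1 : 1 <= ln (m j)%:R :> R by near: j; exact: ln_m_large.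
have m0 : 0 < ((m j)%:R : R) by rewrite ltr0n.
have Lm : alpha * ln (m j)%:R <= (m j)%:R.
  rewrite -[leRHS]lnK ?posrE // -[in leRHS](mul1r (ln _)).
  by near: j; apply: linear_le_expR.
have ln_n : ln (k j * m j)%:R <= 2 * ln (m j)%:R :> R by near: j; exact: (@ln_n_le 1).
have kj : (k j)%:R <= (gamma + eta) * ln (m j)%:R by near: j; exact: k_le_ln_m.
have sqrt_le : C * Num.sqrt (alpha * ln (m j)%:R + 2 * ln (m j)%:R + 1) <= eps * ln (m j)%:R.
  have L2 : (alpha + 3) / (eps / C) ^+ 2 <= ln (m j)%:R by near: j; exact: ln_m_large.
  move: L1 L2; set L := ln _ => L1 L2.
  have L0 : 0 <= L by apply: le_trans L1.
  have eC : 0 < eps / C by rewrite divr_gt0.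
  rewrite -ler_pdivlMl // mulrA [C^-1 * _]mulrC.
  apply: le_trans (_ : Num.sqrt ((eps / C * L) ^+ 2) <= _); last first.
    by rewrite sqrtr_sqr ger0_norm // mulr_ge0 // ltW.
  apply: ler_wsqrtr; apply: le_trans (_ : (alpha + 3) * L <= _); first lra.
  rewrite exprMn [L ^+ 2]expr2 mulrA; apply: ler_wpM2r => //.
  by rewrite mulrC -ler_pdivrMr // exprn_gt0.
have L_large : (expR 1 + 3 + (t * (eps / 2))^-1) * (gamma + eta) ^+ 2 * ln (m j)%:R ^+ 2
    <= expR (omega / 2 * ln (m j)%:R).
  by near: j; exact: quadratic_le_expR.
move=> sigma eqc.
exact: (sbm_recovery_instance beta_gt0 beta_lt gamma_ge0 eta0 eps0 omega0 eta_small t01 t_eps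
  exponent omega1 omega_t (k_ge2 j) (m_ge1 j) L1 Lm ln_n kj sqrt_le L_large).
Unshelve. all: by end_near. Qed.

End Sequences.
End Asymptotics.

Local Open Scope classical_set_scope.
Local Open Scope ring_scope.

Theorem theorem1 (R : realType) :
  exists2 c : R, 0 < c &
  forall (alpha beta : R) (k m : nat -> nat),
    0 < beta -> beta < alpha ->
    (forall t, (2 <= k t)%N) -> (forall t, (1 <= m t)%N) ->
    (fun t => (k t * m t)%N) @ \oo --> \oo ->
    (fun t => (k t)%:R : R^o) =O_\oo (fun t => ln (m t)%:R : R^o) ->
    ((fun t => (k t)%:R : R^o) =o_\oo (fun t => ln (k t * m t)%:R : R^o) ->
     1 < Num.sqrt alpha - Num.sqrt beta ->
     recovers_whp alpha beta k m)
    /\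
    (forall gamma : R, 0 < gamma ->
     (fun t => (k t)%:R : R^o)
       = (fun t => gamma * ln (k t * m t)%:R : R^o)
         +o_\oo (fun t => ln (k t * m t)%:R : R^o) ->
     Num.sqrt (1 + c * Num.sqrt (beta * gamma)
                     * (1 + ln (Num.sqrt (alpha / beta))))
       < Num.sqrt alpha - Num.sqrt beta ->
     recovers_whp alpha beta k m).
Proof.
exists (spectral_const R) => [|alpha beta k m beta0 beta_lt k2 m1 n_oo kO].
  exact: spectral_const_gt0.
have k_bigO : exists2 K : R, 0 < K & \forall t \near \oo, (k t)%:R <= K * ln (m t)%:R.
  move/eqO_exP: kO => [K K0 kK]; exists K => //; apply: filterS kK => t.
  by rewrite ger0_norm // ger0_norm // ln_ge0 // ler1n.
have ln_n0 t : 0 <= ln (k t * m t)%:R :> R.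
  by rewrite ln_ge0 // ler1n muln_gt0 m1 andbT; apply: leq_trans (k2 t).
split=> [ko gap|gamma gamma0 ko gap].
  apply: (recovers_whp_of_gap beta0 beta_lt (lexx 0) k2 m1 n_oo k_bigO) => [e e0|].
    move/eqoP: ko => /(_ e e0); apply: filterS => t.
    by rewrite ger0_norm // ger0_norm // add0r.
  by rewrite mulr0 sqrtr0 mulr0 mul0r addr0 exprn_egt1 //; lra.
apply: (recovers_whp_of_gap beta0 beta_lt (ltW gamma0) k2 m1 n_oo k_bigO) => [e e0|].
  move/eqaddoP: ko => /(_ e e0); apply: filterS => t.
  rewrite [`|ln _|]ger0_norm // => /(le_trans (ler_norm _)).
  by rewrite !fctE mulrDl; lra.
have theta0 := ltW (ln_sqrt_ratio_gt0 beta0 beta_lt).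
set X := (X in X < _ ^+ 2).
have X0 : 0 <= X.
  apply: addr_ge0 => //; apply: mulr_ge0; last exact: addr_ge0.
  by apply: mulr_ge0; [exact: ltW (spectral_const_gt0 R)|exact: sqrtr_ge0].
by rewrite -[ltLHS](sqr_sqrtr X0) ltr_pXn2r // nnegrE ?sqrtr_ge0 // (le_trans (sqrtr_ge0 X)) // ltW.
Qed.
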